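(* Let $\mathcal X$ be a finite state space, $\mathcal H:\mathcal X\to\mathbb R$, $Q$ a symmetric irreducible generator on $\mathcal X$, and let $f,c,\alpha$ satisfy the standing assumption described in the context, with $\alpha$ constant in time. Given $\eta,\varepsilon>0$ and $g\in\ell^2(\mu)$ with $\|g\|_\infty\le a$, if $$t\ge\frac{Z^f_{1,\alpha,c}}{Z^0}\,\frac{32a^2(1+\eta)^2}{\lambda_2(-M^f_{1,\alpha,c})\,\eta^2}\,\ln\left(\frac{1}{\varepsilon\min_{x\in\mathcal X}\mu^f_{1,\alpha,c}(x)}\right),$$ then for any $x\in\mathcal X$, $$\mathbb P_x\left(\frac{\int_0^t w(X^f_{1,\alpha,c}(s))\,g(X^f_{1,\alpha,c}(s))\,ds}{\int_0^t w(X^f_{1,\alpha,c}(s))\,ds}-\mu(g)\ge\eta\right)\le\varepsilon .$$ In particular, $$t_{conc}(\eta,\varepsilon)=\mathcal O\left(|\mathcal X|\,\frac{a^2(1+\eta)^2}{\lambda_2(-M^f_{1,\alpha,c})\,\eta^2}\,\ln\left(\frac{|\mathcal X|\exp\{\max_{x\in\mathcal X}\mathcal H^f_{1,\alpha,c}(x)\}}{\varepsilon}\right)\right).$$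
   Context: Setting. $\mathcal X$ is a finite set, $\mathcal H:\mathcal X\to\mathbb R$, $\mathcal H_{\min}=\min_x\mathcal H(x)$, $\mathcal H_{\max}=\max_x\mathcal H(x)$, $\mu(x)\propto e^{-\mathcal H(x)}$ the target probability distribution, $\mu(g)=\sum_x g(x)\mu(x)$, $\|g\|_\infty=\sup_x|g(x)|$. $Q$ is a symmetric irreducible generator on $\mathcal X$ (the proposal chain). Standing assumption: $f:\mathbb R^+\to\mathbb R^+$ is differentiable, non-negative, non-decreasing with $f(0)=0$; $\mathcal H_{\min}\le c\le\mathcal H_{\max}$; $\alpha\ge0$. Landscape-modified Hamiltonian: $\mathcal H^f_{1,\alpha,c}(x)=\int_{\mathcal H_{\min}}^{\mathcal H(x)}\frac{1}{\alpha f((u-c)_+)+1}\,du$, where $y_+=\max\{y,0\}$. $\mu^f_{1,\alpha,c}(x)=e^{-\mathcal H^f_{1,\alpha,c}(x)}/Z^f_{1,\alpha,c}$ with $Z^f_{1,\alpha,c}=\sum_x e^{-\mathcal H^f_{1,\alpha,c}(x)}$, and $Z^0=\sum_x e^{-(\mathcal H(x)-\mathcal H_{\min})}$. $X^f_{1,\alpha,c}$ is the continuous-time Markov chain with generator $M^f_{1,\alpha,c}(x,y)=Q(x,y)e^{-(\mathcal H^f_{1,\alpha,c}(y)-\mathcal H^f_{1,\alpha,c}(x))_+}$ for $x\ne y$, $M^f_{1,\alpha,c}(x,x)=-\sum_{y\neq x}M^f_{1,\alpha,c}(x,y)$; $\mathbb P_x$ is its law started at $x$. Spectral gap: $\lambda_2(-M^f_{1,\alpha,c})=\inf\{\langle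 -M^f_{1,\alpha,c}g,g\rangle_{\mu^f_{1,\alpha,c}}/\langle g,g\rangle_{\mu^f_{1,\alpha,c}}:g\ne0,\ \mu^f_{1,\alpha,c}(g)=0\}$, with $\langle g_1,g_2\rangle_\nu=\sum_x g_1(x)g_2(x)\nu(x)$. Weight function: $w(x)=e^{-(\mathcal H(x)-\mathcal H_{\min})}/e^{-\mathcal H^f_{1,\alpha,c}(x)}$. For given $a>0$, $$t_{conc}(\eta,\varepsilon)=\inf\Big\{t\ge0:\ \sup_{g\in\ell^2(\mu),\,\|g\|_\infty\le a}\ \sup_{x\in\mathcal X}\mathbb P_x\Big(\tfrac{\int_0^t w(X^f_{1,\alpha,c}(s))g(X^f_{1,\alpha,c}(s))\,ds}{\int_0^t w(X^f_{1,\alpha,c}(s))\,ds}-\mu(g)\ge\eta\Big)\le\varepsilon\Big\}.$$ The constant implicit in $\mathcal O$ is absolute. *)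

(* Defs.v *)
From HB Require Import structures.
From mathcomp Require Import all_boot all_order all_algebra.
From mathcomp Require Import all_classical all_reals all_analysis.
Set Implicit Arguments.
Unset Strict Implicit.
Unset Printing Implicit Defensive.
Import Order.TTheory GRing.Theory Num.Theory.
Import numFieldNormedType.Exports.
Local Open Scope classical_set_scope.
Local Open Scope ring_scope.

(* On a finite nonempty type, [inf (range F)] and [sup (range F)] are the
   minimum and the maximum of F. *)

Section FiniteStateSpace.
Context {R : realType} {S : finType}.
Implicit Types (H E g nu : S -> R) (Q M : S -> S -> R).

Definition mean nu g : R := \sum_x g x * nu x.

Definition inner nu g1 g2 : R := \sum_x g1 x * g2 x * nu x.

Definition sup_norm g : R := sup (range (fun x => `|g x|)).

Definition partition_fun E : R := \sum_x expR (- E x).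

Definition gibbs E (x : S) : R := expR (- E x) / partition_fun E.

Definition is_generator Q : Prop :=
  (forall x y, x != y -> 0 <= Q x y) /\ (forall x, \sum_y Q x y = 0).

Definition symmetric_rates Q : Prop := forall x y, Q x y = Q y x.

Definition irreducible_rates Q : Prop :=
  forall x y, connect [rel u v | (u != v) && (0 < Q u v)] x y.

(* Metropolis generator with proposal Q and energy E. *)
Definition metropolis Q E (x y : S) : R :=
  let rate u v := Q u v * expR (- Num.max (E v - E u) 0) in
  if x == y then - \sum_(z | z != x) rate x z else rate x y.

Definition apply_gen M g (x : S) : R := \sum_y M x y * g y.

(* When S is a singleton the set of Rayleigh quotients is empty and this real
   infimum is 0 instead of +oo; in both cases its inverse is 0. *)
Definition spectral_gap M nu : R :=
  inf [set r | exists g, [/\ g <> (fun=> 0), mean nu g = 0 &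
    r = inner nu (fun x => - apply_gen M g x) g / inner nu g g]].

Fixpoint kernel_power M (k : nat) : S -> S -> R :=
  if k is k'.+1 then fun x y => \sum_z M x z * kernel_power M k' z y
  else fun x y => (x == y)%:R.

(* Entries of the matrix exponential e^{tM}. *)
Definition semigroup M (t : R) (x y : S) : R :=
  limn (series (fun k => t ^+ k / k`!%:R * kernel_power M k x y)).

(* X, under the family of laws (P x)_x, is the right-continuous continuous-time
   Markov chain with generator M, started at x under P x. Only times t >= 0
   matter. Taking n = 0 in the last clause gives X 0 = x almost surely. *)
Definition markov_chain M d (Omega : measurableType d)
    (P : S -> probability Omega R) (X : R -> Omega -> S) : Prop :=
  [/\ forall t y, 0 <= t -> measurable (X t @^-1` [set y]),
      forall omega t, 0 <= t -> \forall s \near t^'+, X s omega = X t omega &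
      forall x n (ts : nat -> R) (ys : nat -> S),
        ts 0%N = 0 -> (forall i j, (i <= j)%N -> ts i <= ts j) ->
        P x [set omega | forall i, (i <= n)%N -> X (ts i) omega = ys i] =
        ((ys 0%N == x)%:R *
         \prod_(i < n) semigroup M (ts i.+1 - ts i) (ys i) (ys i.+1))%:E].

(* Ratio of the time integrals of w g and w over [0, t]. At t = 0, where the
   ratio is 0 / 0, it is given its limit as t -> 0+ along a right-continuous
   path (for positive w). *)
Definition weighted_time_average (w g : S -> R) (path : R -> S) (t : R) : R :=
  if t == 0 then g (path 0)
  else (\int[lebesgue_measure]_(s in `[0, t]) (w (path s) * g (path s))) /
       (\int[lebesgue_measure]_(s in `[0, t]) w (path s)).

End FiniteStateSpace.

(* Differentiability on [0, +oo[, one-sided at 0; the values of f at negative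
   arguments are irrelevant. *)
Definition differentiable_on_Rplus {R : realType} (f : R -> R) : Prop :=
  forall u, 0 <= u ->
    cvg ((fun v => (f v - f u) / (v - u)) @ within [set v | 0 <= v] u^').

Section LandscapeModification.
Context {R : realType} {S : finType}.
Variables (H : S -> R) (f : R -> R) (alpha c : R).

Definition Hmin : R := inf (range H).
Definition Hmax : R := sup (range H).

Definition standing_assumption : Prop :=
  [/\ differentiable_on_Rplus f,
      forall u, 0 <= u -> 0 <= f u,
      forall u v, 0 <= u -> u <= v -> f u <= f v,
      f 0 = 0 &
      Hmin <= c <= Hmax /\ 0 <= alpha].

Definition modified_H (x : S) : R :=
  \int[lebesgue_measure]_(u in `[Hmin, H x])
    (alpha * f (Num.max (u - c) 0) + 1)^-1.

Definition mu_f : S -> R := gibbs modified_H.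

Definition Z_f : R := partition_fun modified_H.

Definition Z_0 : R := partition_fun (fun x => H x - Hmin).

Definition modified_gen (Q : S -> S -> R) : S -> S -> R :=
  metropolis Q modified_H.

Definition gap_f (Q : S -> S -> R) : R := spectral_gap (modified_gen Q) mu_f.

Definition weight (x : S) : R :=
  expR (- (H x - Hmin)) / expR (- modified_H x).

Definition deviation_event d (Omega : measurableType d) (X : R -> Omega -> S)
    (g : S -> R) (t eta : R) : set Omega :=
  [set omega | eta <= weighted_time_average weight g (X ^~ omega) t
                      - mean (gibbs H) g].

(* Valued in \bar R, so that it is +oo if no time t qualifies. *)
Definition t_conc d (Omega : measurableType d) (P : S -> probability Omega R)
    (X : R -> Omega -> S) (a eta eps : R) : \bar R :=
  ereal_inf (EFin @` [set t | 0 <= t /\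
    (ereal_sup [set p : \bar R | exists (g : S -> R) (x : S),
       (sup_norm g <= a)%R /\ p = P x (deviation_event X g t eta)]
     <= eps%:E)%E]).

End LandscapeModification.

(* Main.v *)
(** Chernoff bound through Feynman-Kac. For [t > 0] the deviation event says
    that the time integral of [h = rho (g - mu g - eta)] along the chain is
    nonnegative, where [rho] is the normalized weight, i.e. the density of the
    target [mu] with respect to the invariant law [nu] of the modified chain.
    Right Riemann sums converge along every right-continuous path, and their
    exponential moments are iterates of the tilted kernel [e^{sM} e^{s theta h}],
    which contracts L2(nu) at the rate at which the quadratic form of
    [M + theta h] is negative. Splitting [u] into its mean and its fluctuation,
    the mean part contributes [- theta eta], the fluctuation [- gap], and the
    cross term is controlled by [nu (h^2) <= K (a^2 + eta^2)] with
    [K = Z_f / Z_0]; the choice [theta = 2 lambda / eta] yields the rate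
    [lambda = gap eta^2 / (32 a^2 K)] as soon as [eta <= 2 a], and for larger
    [eta] the event is empty. *)

Require Import Defs.
From mathcomp Require Import all_boot all_order all_algebra.
From mathcomp Require Import all_classical all_reals all_analysis.
From mathcomp Require Import measurable_realfun ring lra.
Set Implicit Arguments.
Unset Strict Implicit.
Unset Printing Implicit Defensive.
Import Order.TTheory GRing.Theory Num.Theory.
Import numFieldNormedType.Exports.
Local Open Scope classical_set_scope.
Local Open Scope ring_scope.

(** * Reversible generators and the spectral gap *)

Section ReversibleGenerator.
Context {R : realType} {S : finType}.
Variables (M : S -> S -> R) (nu : S -> R).
Hypothesis nu_gt0 : forall x, 0 < nu x.
Hypothesis nu_sum1 : \sum_x nu x = 1.
Hypothesis M_gen : is_generator M.
Hypothesis M_rev : forall x y, nu x * M x y = nu y * M y x.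
Implicit Types (g phi : S -> R).

Lemma inner_ge0 g : 0 <= inner nu g g.
Proof. by apply: sumr_ge0 => x _; rewrite mulr_ge0 ?(ltW (nu_gt0 x)) // -expr2 sqr_ge0. Qed.

Lemma inner_eq0 g : inner nu g g = 0 -> g = fun=> 0.
Proof.
move=> /eqP; rewrite psumr_eq0 => [/allP h|x _]; last first.
  by rewrite mulr_ge0 ?(ltW (nu_gt0 x)) // -expr2 sqr_ge0.
apply/funext => x; have /implyP/(_ isT) := h x (mem_index_enum x).
by rewrite mulf_eq0 (gt_eqF (nu_gt0 x)) orbF mulf_eq0 orbb => /eqP.
Qed.

Lemma mean_le_sup g b : (forall x, g x <= b) -> mean nu g <= b.
Proof.
move=> gb; rewrite -[leRHS]mulr1 -nu_sum1 mulr_sumr.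
by apply: ler_sum => x _; rewrite ler_wpM2r // ltW.
Qed.

(** Detailed balance turns the column sums of [nu x * M x y] into row sums of [M], which vanish:
    [nu] is invariant. *)
Lemma apply_gen_stationary g : mean nu (apply_gen M g) = 0.
Proof.
rewrite /mean /apply_gen.
transitivity (\sum_y (\sum_x M y x) * (g y * nu y)).
  under eq_bigr do rewrite mulr_suml.
  rewrite exchange_big; apply: eq_bigr => y _; rewrite mulr_suml.
  by apply: eq_bigr => x _; rewrite mulrAC [_ * nu x]mulrC M_rev; ring.
by rewrite big1 // => y _; case: M_gen => _ ->; rewrite mul0r.
Qed.

Lemma apply_gen_shift g b : apply_gen M (fun x => b + g x) = apply_gen M g.
Proof.
apply/funext => x; rewrite /apply_gen.
under eq_bigr do rewrite mulrDr.
by rewrite big_split /= -mulr_suml; case: M_gen => _ ->; rewrite mul0r add0r.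
Qed.

(** Expanding the square, the [g x ^+ 2] part vanishes by the zero row sums and the [g y ^+ 2] part
    reduces to it by reversibility; only the cross term survives. *)
Lemma dirichlet_formE g : inner nu (fun x => - apply_gen M g x) g =
  2^-1 * \sum_x \sum_y nu x * M x y * (g y - g x) ^+ 2.
Proof.
have rowsum : \sum_x \sum_y nu x * M x y * g x ^+ 2 = 0.
  rewrite big1 // => x _; rewrite -mulr_suml -mulr_sumr.
  by case: M_gen => _ ->; rewrite mulr0 mul0r.
have colsum : \sum_x \sum_y nu x * M x y * g y ^+ 2 = 0.
  rewrite exchange_big -[RHS]rowsum; apply: eq_bigr => x _.
  by apply: eq_bigr => y _; rewrite M_rev.
have cross : inner nu (fun x => - apply_gen M g x) g =
    - \sum_x \sum_y nu x * M x y * (g x * g y).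
  rewrite /inner /apply_gen -sumrN; apply: eq_bigr => x _.
  rewrite -mulrA mulNr mulr_suml; congr (- _); apply: eq_bigr => y _; ring.
have -> : \sum_x \sum_y nu x * M x y * (g y - g x) ^+ 2 =
   \sum_x \sum_y nu x * M x y * g y ^+ 2
   + \sum_x \sum_y nu x * M x y * g x ^+ 2
   - 2 * \sum_x \sum_y nu x * M x y * (g x * g y).
  rewrite mulr_sumr -big_split -sumrB; apply: eq_bigr => x _ /=.
  rewrite mulr_sumr -big_split -sumrB; apply: eq_bigr => y _ /=; ring.
by rewrite rowsum colsum cross; field.
Qed.

(** Off the diagonal the rates are nonnegative; on the diagonal the increment is zero. *)
Lemma dirichlet_term_ge0 g x y : 0 <= nu x * M x y * (g y - g x) ^+ 2.
Proof.
have [->|xy] := eqVneq x y; first by rewrite subrr expr0n mulr0.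
by rewrite mulr_ge0 ?sqr_ge0 // mulr_ge0 ?(ltW (nu_gt0 _)) //; case: M_gen => ->.
Qed.

Lemma dirichlet_form_ge0 g : 0 <= inner nu (fun x => - apply_gen M g x) g.
Proof.
rewrite dirichlet_formE mulr_ge0 ?invr_ge0 //.
by apply: sumr_ge0 => x _; apply: sumr_ge0 => y _; exact: dirichlet_term_ge0.
Qed.

Lemma dirichlet_form_edge g x y :
  nu x * M x y * (g y - g x) ^+ 2 <=
  2 * inner nu (fun x => - apply_gen M g x) g.
Proof.
rewrite dirichlet_formE [leRHS]mulrA mulfV ?pnatr_eq0 // mul1r.
rewrite (bigD1 x) //= (bigD1 y) //= -addrA lerDl addr_ge0 //.
  by apply: sumr_ge0 => z _; exact: dirichlet_term_ge0.
by apply: sumr_ge0 => u _; apply: sumr_ge0 => z _; exact: dirichlet_term_ge0.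
Qed.

(** * Poincaré inequality and positivity of the spectral gap *)

Hypothesis M_irr : irreducible_rates M.

(** Induction along a path of positive rates from [x] to [y]: each edge is controlled by the
    Dirichlet form, and [(p + q)^2 <= 2 p^2 + 2 q^2] glues an edge to the rest of the path. Only the
    existence of some constant matters. *)
Lemma path_comparison x y : exists2 C, 0 <= C & forall g,
  (g y - g x) ^+ 2 <= C * inner nu (fun x => - apply_gen M g x) g.
Proof.
have /connectP[p] := M_irr x y.
elim: p x => [x _ ->|z p IH x /= /andP[/andP[xz Mxz] zp] yE].
  by exists 0 => // g; rewrite subrr expr0n mul0r.
have [C C0 CP] := IH z zp yE.
have k0 : 0 < nu x * M x z by rewrite mulr_gt0.
exists (4 / (nu x * M x z) + 2 * C).
  by rewrite addr_ge0 ?mulr_ge0 ?invr_ge0 ?(ltW k0).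
move=> g; have := CP g; have := dirichlet_form_edge g x z.
set D := inner _ _ _ => h1 h2.
have {}h1 : (g z - g x) ^+ 2 <= 2 / (nu x * M x z) * D.
  by rewrite mulrAC ler_pdivlMr // mulrC.
apply: (@le_trans _ _ (2 * (g z - g x) ^+ 2 + 2 * (g y - g z) ^+ 2)); last first.
  have -> : (4 / (nu x * M x z) + 2 * C) * D =
    2 * (2 / (nu x * M x z) * D) + 2 * (C * D).
    by rewrite mulrDl; ring.
  by rewrite lerD // ler_wpM2l.
have := sqr_ge0 ((g z - g x) - (g y - g z)); nra.
Qed.

(** The variance is half the mean square difference of two independent copies. *)
Lemma variance_pairs g : mean nu g = 0 ->
  inner nu g g = 2^-1 * \sum_x \sum_y nu x * nu y * (g y - g x) ^+ 2.
Proof.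
rewrite /mean /inner => g0.
have -> : \sum_x \sum_y nu x * nu y * (g y - g x) ^+ 2 =
   \sum_x (nu x * \sum_y g y * g y * nu y + (\sum_y nu y) * (g x * g x * nu x)
      - 2 * (g x * nu x) * \sum_y g y * nu y).
  apply: eq_bigr => x _; rewrite !mulr_sumr mulr_suml -big_split -sumrB.
  by apply: eq_bigr => y _ /=; ring.
by rewrite sumrB big_split /= -!mulr_suml -!mulr_sumr nu_sum1 g0; field.
Qed.

Lemma poincare : exists2 C, 0 < C & forall g, mean nu g = 0 ->
  inner nu g g <= C * inner nu (fun x => - apply_gen M g x) g.
Proof.
pose CP x y := cid2 (path_comparison x y).
pose C x y := s2val (CP x y).
(* The path constants are averaged over all pairs of endpoints; the [+ 1] only makes the constant
   strictly positive. *)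
exists (2^-1 * (\sum_x \sum_y nu x * nu y * C x y) + 1).
  rewrite ltr_wpDl // mulr_ge0 ?invr_ge0 //.
  apply: sumr_ge0 => x _; apply: sumr_ge0 => y _.
  by rewrite !mulr_ge0 ?(ltW (nu_gt0 _)) // /C; case: (CP x y).
move=> g g0; rewrite (variance_pairs g0) mulrDl mul1r ler_wpDr ?dirichlet_form_ge0//.
rewrite -mulrA ler_wpM2l ?invr_ge0 // mulr_suml; apply: ler_sum => x _.
rewrite mulr_suml; apply: ler_sum => y _.
rewrite -[leRHS]mulrA ler_wpM2l ?mulr_ge0 ?(ltW (nu_gt0 _)) //.
by rewrite /C; case: (CP x y) => /= b _ ->.
Qed.

Local Notation gap := (spectral_gap M nu).

Lemma spectral_gap_le g : mean nu g = 0 ->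
  gap * inner nu g g <= inner nu (fun x => - apply_gen M g x) g.
Proof.
move=> g0; have [/eqP|gn0] := eqVneq (inner nu g g) 0.
  by move=> /eqP ->; rewrite mulr0 dirichlet_form_ge0.
have gp : 0 < inner nu g g by rewrite lt_neqAle eq_sym gn0 inner_ge0.
rewrite -ler_pdivlMr //; apply: ge_inf.
  exists 0 => _ [u [_ _ ->]].
  by rewrite divr_ge0 ?inner_ge0 ?dirichlet_form_ge0.
exists g; split => //; apply: contra_neq_not gn0 => ->.
by rewrite /inner big1 // => x _; rewrite !mul0r.
Qed.

(** The Poincaré constant bounds every Rayleigh quotient from below. Two states are required so that
    such a quotient exists, since the infimum of the empty set is 0. *)
Lemma spectral_gap_gt0 : (1 < #|S|)%N -> 0 < gap.
Proof.
move=> /card_gt1P[x [y [_ _ xy]]].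
have [C C0 CP] := poincare.
apply: (@lt_le_trans _ _ C^-1); first by rewrite invr_gt0.
apply: lb_le_inf.
  (* Difference of two point masses, each normalized to have [nu]-mean 1: a nonzero function of mean
     zero. *)
  pose g z := (z == x)%:R / nu x - (z == y)%:R / nu y : R.
  eexists; exists g; split; last by [].
    move=> /(congr1 (@^~ x)); rewrite /g eqxx (negbTE xy) mul0r subr0 mul1r.
    by move/eqP; rewrite invr_eq0 gt_eqF.
  have delta z : \sum_u (u == z)%:R / nu z * nu u = 1.
    rewrite (bigD1 z) //= eqxx big1 => [|u /negbTE->]; last by rewrite !mul0r.
    by rewrite addr0 mul1r mulVf ?gt_eqF.
  rewrite /mean /g; under eq_bigr do rewrite mulrBl.
  by rewrite sumrB !delta subrr.
move=> _ [g [gn0 g0 ->]].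
have gp : 0 < inner nu g g.
  by rewrite lt_neqAle inner_ge0 andbT eq_sym; apply/eqP => /inner_eq0.
by rewrite ler_pdivlMr // ler_pdivrMl // CP.
Qed.

End ReversibleGenerator.

(** * Short-time expansion of the tilted kernel *)

Lemma exp_coeff_partial_sum_le {R : realType} (y : R) n :
  0 <= y -> \sum_(k < n) y ^+ k / k`!%:R <= expR y.
Proof.
move=> y0; rewrite /expR.
have mono : nondecreasing_seq (series (exp_coeff y)).
  apply/nondecreasing_seqP => m; rewrite /series /= big_nat_recr //= lerDl.
  by rewrite /exp_coeff /= divr_ge0 ?exprn_ge0.
have := nondecreasing_cvgn_le mono (is_cvg_series_exp_coeff y) n.
by rewrite /series /exp_coeff /= big_mkord.
Qed.

(** Since [k! <= (k+2)!], the terms from index 2 on are dominated by [y ^+ 2] times the exponential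
    series. *)
Lemma limn_series_first_order {R : realType} (b : R ^nat) (y : R) :
  0 <= y -> (forall k, `|b k| <= y ^+ k / k`!%:R) ->
  `|limn (series b) - (b 0%N + b 1%N)| <= y ^+ 2 * expR y.
Proof.
move=> y0 bb.
have bcvg : cvgn (series b).
  apply: normed_cvg; apply: (@series_le_cvg _ _ (exp_coeff y)) => [k|k|k|].
  - exact: normr_ge0.
  - by rewrite /exp_coeff /= divr_ge0 ?exprn_ge0.
  - exact: bb.
  - exact: is_cvg_series_exp_coeff.
have tail n : `|series b (n.+2) - (b 0%N + b 1%N)| <= y ^+ 2 * expR y.
  rewrite /series /= big_nat_recl // big_nat_recl // addrA [X in X - _]addrC addrK.
  rewrite big_mkord (le_trans (ler_norm_sum _ _ _)) //.
  apply: le_trans (ler_wpM2l (exprn_ge0 2 y0) (exp_coeff_partial_sum_le n y0)).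
  rewrite mulr_sumr; apply: ler_sum => k _; apply: (le_trans (bb _)).
  rewrite -addn2 addnC exprD -mulrA ler_wpM2l ?exprn_ge0 // ler_wpM2l ?exprn_ge0 //.
  rewrite lef_pV2 ?posrE ?ltr0n ?fact_gt0 // ler_nat add2n !factS.
  by rewrite mulnA leq_pmull.
have cv : `|series b n.+2 - (b 0%N + b 1%N)| @[n --> \oo] -->
    `|limn (series b) - (b 0%N + b 1%N)|.
  apply: cvg_norm; apply: cvgB; last exact: cvg_cst.
  have := bcvg; rewrite -(cvg_shiftn 2) => h.
  by under eq_fun do rewrite -addn2.
rewrite -(cvg_lim (@Rhausdorff R) cv); apply: limr_le; first exact: cvgP cv.
by apply: nearW => n; exact: tail.
Qed.

Lemma expR_first_order {R : realType} (x : R) :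
  `|expR x - (1 + x)| <= x ^+ 2 * expR `|x|.
Proof.
have := @limn_series_first_order R (exp_coeff x) `|x| (normr_ge0 x).
rewrite -/(expR x) /exp_coeff /= expr0 expr1 fact0 !divr1 real_normK ?num_real //; apply => k.
by rewrite normrM normrX normfV [`|_%:R|]ger0_norm.
Qed.

Section SemigroupExpansion.
Context {R : realType} {S : finType}.
Variables (M : S -> S -> R).

Local Notation L := (\sum_x \sum_y `|M x y|).

Lemma entry_le_sum x y : `|M x y| <= L.
Proof.
rewrite (bigD1 x) //= (bigD1 y) //= -addrA lerDl addr_ge0 //.
  by apply: sumr_ge0.
by apply: sumr_ge0 => u _; apply: sumr_ge0.
Qed.

Lemma row_le_sum x : \sum_y `|M x y| <= L.
Proof.
rewrite [leRHS](bigD1 x) //= lerDl; apply: sumr_ge0 => u _; exact: sumr_ge0.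
Qed.

Lemma sum_norm_ge0 : 0 <= L.
Proof. by apply: sumr_ge0 => x _; apply: sumr_ge0. Qed.

(** [L] dominates every absolute row sum, so it plays the role of an operator norm. *)
Lemma kernel_power_le k x y : `|kernel_power M k x y| <= L ^+ k.
Proof.
elim: k x y => [x y|k IH x y] /=.
  by case: eqP; rewrite expr0 ?normr1 ?normr0.
rewrite (le_trans (ler_norm_sum _ _ _)) // exprS.
apply: le_trans (ler_wpM2r (exprn_ge0 k sum_norm_ge0) (row_le_sum x)).
by rewrite mulr_suml; apply: ler_sum => z _; rewrite normrM ler_wpM2l.
Qed.

Lemma semigroup_first_order (t : R) x y : 0 <= t ->
  `|semigroup M t x y - ((x == y)%:R + t * M x y)| <=
    (t * L) ^+ 2 * expR (t * L).
Proof.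
move=> t0; rewrite /semigroup.
set b := fun k : nat => _.
have /= := @limn_series_first_order R b (t * L) (mulr_ge0 t0 sum_norm_ge0).
have -> : b 0%N = (x == y)%:R by rewrite /b /= expr0 fact0 divr1 mul1r.
have -> : b 1%N = t * M x y.
  rewrite /b /= expr1 divr1 (bigD1 y) //= eqxx mulr1 big1 ?addr0 //.
  by move=> z /negbTE ->; rewrite mulr0.
apply => k; rewrite /b !normrM normfV normrX (ger0_norm t0) [`|_%:R|]ger0_norm //.
rewrite exprMn mulrAC ler_wpM2r ?invr_ge0 // ler_wpM2l ?exprn_ge0 //.
exact: kernel_power_le.
Qed.

End SemigroupExpansion.

(** * Contraction of the tilted kernel in L2 *)

Section TiltedKernel.
Context {R : realType} {S : finType}.
Variables (M : S -> S -> R) (nu h : S -> R).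
Hypothesis nu_gt0 : forall x, 0 < nu x.
Hypothesis nu_sum1 : \sum_x nu x = 1.
Implicit Types u : S -> R.

(** One step of the discretized Feynman-Kac semigroup. The tilt acts at the end of the step, which
    matches Riemann sums with right endpoints. *)
Definition tilted_step (t : R) u (x : S) : R :=
  \sum_y semigroup M t x y * (expR (t * h y) * u y).

Local Notation norm2 u := (Num.sqrt (inner nu u u)).

Lemma nu_le1 x : nu x <= 1.
Proof.
rewrite -nu_sum1 (bigD1 x) //= lerDl; apply: sumr_ge0 => y _; exact: ltW.
Qed.

Lemma sqr_norm2 u : norm2 u ^+ 2 = inner nu u u.
Proof. by rewrite sqr_sqrtr //; exact: inner_ge0. Qed.

(** From [nu x <= 1], [(nu x * u x)^2 <= nu x * u x ^+ 2], a single term of the squared norm. The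
    factor [1 / nu x] is the source of the minimum of the invariant law in the final logarithm. *)
Lemma norm_le_norm2 u x : `|u x| <= norm2 u / nu x.
Proof.
rewrite ler_pdivlMr // -(ler_pXn2r (n:=2)) ?nnegrE ?mulr_ge0 ?sqrtr_ge0 ?(ltW (nu_gt0 x)) //.
rewrite sqr_norm2 exprMn real_normK ?num_real // expr2 [nu x ^+ 2]expr2 mulrA.
rewrite /inner (bigD1 x) //= -[leLHS]addr0 lerD //.
  by rewrite ler_piMr ?nu_le1 // mulr_ge0 ?(ltW (nu_gt0 x)) // -expr2 sqr_ge0.
by apply: sumr_ge0 => y _; rewrite mulr_ge0 ?(ltW (nu_gt0 y)) // -expr2 sqr_ge0.
Qed.

Lemma norm_le_norm2_uniform u x : `|u x| <= (\sum_y (nu y)^-1) * norm2 u.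
Proof.
apply: (le_trans (norm_le_norm2 u x)); rewrite mulrC ler_wpM2r ?sqrtr_ge0 //.
rewrite (bigD1 x) //= lerDl; apply: sumr_ge0 => y _; rewrite invr_ge0; exact: ltW.
Qed.

Lemma norm_le_sum_norm x : `|h x| <= \sum_y `|h y|.
Proof. by rewrite (bigD1 x) //= lerDl; apply: sumr_ge0. Qed.

Lemma tilted_kernel_first_order : exists2 C, 0 <= C & forall t x y,
  0 <= t -> t <= 1 ->
  `|semigroup M t x y * expR (t * h y)
    - ((x == y)%:R + t * (M x y + (x == y)%:R * h y))| <= C * t ^+ 2.
Proof.
pose L := \sum_x \sum_y `|M x y|; pose B := \sum_y `|h y|.
have L0 : 0 <= L by exact: sum_norm_ge0.
have B0 : 0 <= B by apply: sumr_ge0.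
(* The three summands bound, in order, the product of the two linear terms, the remainder of the
   exponential times [1 + t M], and the remainder of the semigroup times the exponential. *)
exists (L * B + (1 + L) * (B ^+ 2 * expR B) + L ^+ 2 * expR L * expR B).
  by rewrite !addr_ge0 // !mulr_ge0 ?exprn_ge0 ?expR_ge0 ?addr_ge0.
move=> t x y t0 t1.
have t20 : 0 <= t ^+ 2 by rewrite sqr_ge0.
have hB := norm_le_sum_norm y; rewrite -/B in hB.
have ML := entry_le_sum M x y; rewrite -/L in ML.
have thB : `|t * h y| <= B.
  by rewrite normrM (ger0_norm t0) (le_trans _ hB) // ler_piMl.
set rho := semigroup M t x y - ((x == y)%:R + t * M x y).
set sg := expR (t * h y) - (1 + t * h y).
have rhoP : `|rho| <= t ^+ 2 * (L ^+ 2 * expR L).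
  apply: (le_trans (semigroup_first_order M x y t0)); rewrite -/L exprMn -mulrA.
  rewrite ler_wpM2l // ler_wpM2l ?exprn_ge0 // ler_expR ler_piMl //.
have sgP : `|sg| <= t ^+ 2 * (B ^+ 2 * expR B).
  apply: (le_trans (expR_first_order _)).
  rewrite exprMn -mulrA ler_wpM2l // ler_pM ?sqr_ge0 ?expR_ge0 ?ler_expR //.
  by rewrite -real_normK ?num_real // ler_pXn2r ?nnegrE.
have -> : semigroup M t x y * expR (t * h y)
    - ((x == y)%:R + t * (M x y + (x == y)%:R * h y)) =
    t ^+ 2 * (M x y * h y) + ((x == y)%:R + t * M x y) * sg
    + rho * expR (t * h y).
  by rewrite /rho /sg; ring.
rewrite [leRHS]mulrC [leRHS]mulrDr; apply: (le_trans (ler_normD _ _)); rewrite lerD //.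
  rewrite [leRHS]mulrDr; apply: (le_trans (ler_normD _ _)); rewrite lerD //.
    by rewrite normrM (ger0_norm t20) ler_wpM2l // normrM ler_pM.
  rewrite normrM mulrCA ler_pM //.
  apply: (le_trans (ler_normD _ _)); rewrite lerD //.
    by case: eqP; rewrite ?normr1 ?normr0.
  by rewrite normrM (ger0_norm t0) (le_trans _ ML) // ler_piMl.
rewrite normrM mulrA ler_pM // gtr0_norm ?expR_gt0 // ler_expR.
exact: le_trans (ler_norm _) thB.
Qed.

Lemma mean_norm_le (u : S -> R) b : (forall x, `|u x| <= b) -> `|mean nu u| <= b.
Proof.
move=> ub; rewrite (le_trans (ler_norm_sum _ _ _)) //.
rewrite -[leRHS]mulr1 -nu_sum1 mulr_sumr; apply: ler_sum => x _.
by rewrite normrM (gtr0_norm (nu_gt0 x)) ler_wpM2r // ltW.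
Qed.

Variable lam : R.
Hypothesis form_le : forall u,
  inner nu (fun x => apply_gen M u x + h x * u x) u <= - lam * inner nu u u.

(** Write the step as [u + t A u + r] with [A = M + h] and [r] of order [t ^+ 2]. The first-order
    term of the squared norm is [2 t] times the quadratic form of [A], bounded by [form_le];
    everything else is of second order. *)
Lemma tilted_step_contraction : exists2 C, 0 <= C & forall t u,
  0 <= t -> t <= 1 ->
  inner nu (tilted_step t u) (tilted_step t u) <=
  (1 - 2 * (t * lam) + C * t ^+ 2) * inner nu u u.
Proof.
have [C0 C0_ge0 C0P] := tilted_kernel_first_order.
pose kap := \sum_y (nu y)^-1.
have kap0 : 0 <= kap by apply: sumr_ge0 => y _; rewrite invr_ge0 ltW.
pose l := \sum_x \sum_y `|M x y| + \sum_y `|h y|.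
have l0 : 0 <= l by rewrite addr_ge0 ?sum_norm_ge0 // sumr_ge0.
pose c := C0 * #|S|%:R.
have c0 : 0 <= c by rewrite mulr_ge0.
(* [c] bounds the kernel remainder summed over a row, [l] the size of [A], and [kap] compares the
   sup norm with the L2 norm. The first summand pairs [r] with [u], the second is the square of
   [t A u + r]. *)
exists (2 * (c * kap * kap) + (l * kap + c * kap) ^+ 2).
  by rewrite addr_ge0 ?sqr_ge0 ?mulr_ge0.
move=> t u t0 t1.
pose A x := apply_gen M u x + h x * u x.
pose r x := tilted_step t u x - (u x + t * A x).
pose N := norm2 u.
have N0 : 0 <= N by exact: sqrtr_ge0.
have uP x : `|u x| <= kap * N by exact: norm_le_norm2_uniform.
have AP x : `|A x| <= l * (kap * N).
  rewrite (le_trans (ler_normD _ _)) // mulrDl lerD //.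
    rewrite (le_trans (ler_norm_sum _ _ _)) //.
    apply: le_trans (ler_wpM2r (mulr_ge0 kap0 N0) (row_le_sum M x)).
    by rewrite mulr_suml; apply: ler_sum => y _; rewrite normrM ler_wpM2l.
  by rewrite normrM ler_pM // norm_le_sum_norm.
have rP x : `|r x| <= t ^+ 2 * (c * (kap * N)).
  have -> : r x = \sum_y (semigroup M t x y * expR (t * h y)
    - ((x == y)%:R + t * (M x y + (x == y)%:R * h y))) * u y.
    rewrite /r /A /tilted_step /apply_gen.
    have {1}-> : u x = \sum_y (x == y)%:R * u y.
      rewrite (bigD1 x) //= eqxx mul1r big1 ?addr0 // => y.
      by rewrite eq_sym => /negbTE ->; rewrite mul0r.
    have -> : h x * u x = \sum_y (x == y)%:R * (h y * u y).
      rewrite (bigD1 x) //= eqxx mul1r big1 ?addr0 // => y.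
      by rewrite eq_sym => /negbTE ->; rewrite mul0r.
    rewrite -big_split mulr_sumr -big_split -sumrB; apply: eq_bigr => y _ /=; ring.
  rewrite (le_trans (ler_norm_sum _ _ _)) //.
  have -> : t ^+ 2 * (c * (kap * N)) = \sum_(y : S) (C0 * t ^+ 2 * (kap * N)).
    by rewrite sumr_const -mulr_natr /c; ring.
  by apply: ler_sum => y _; rewrite normrM ler_pM // C0P.
have -> : inner nu (tilted_step t u) (tilted_step t u) =
  inner nu u u + 2 * t * inner nu A u
  + (2 * mean nu (fun x => r x * u x) + mean nu (fun x => (t * A x + r x) ^+ 2)).
  rewrite /inner /mean !mulr_sumr -!big_split; apply: eq_bigr => x _ /=.
  by rewrite /r; ring.
have -> : (1 - 2 * (t * lam) + (2 * (c * kap * kap) + (l * kap + c * kap) ^+ 2) * t ^+ 2)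
    * inner nu u u =
  inner nu u u + 2 * t * (- lam * inner nu u u)
  + (2 * (t ^+ 2 * (c * (kap * N)) * (kap * N))
     + (t * (l * (kap * N)) + t * (c * (kap * N))) ^+ 2).
  by rewrite -sqr_norm2 -/N; ring.
rewrite lerD //.
  by rewrite lerD2l ler_wpM2l ?mulr_ge0 //; exact: form_le.
rewrite lerD //.
  rewrite ler_wpM2l // (le_trans (ler_norm _)) // mean_norm_le // => x.
  by rewrite normrM ler_pM.
rewrite (le_trans (ler_norm _)) // mean_norm_le // => x.
rewrite normrX ler_pXn2r ?nnegrE ?addr_ge0 ?mulr_ge0 //.
apply: (le_trans (ler_normD _ _)); rewrite lerD //.
  by rewrite normrM (ger0_norm t0) ler_wpM2l.
apply: (le_trans (rP x)); rewrite ler_wpM2r ?mulr_ge0 //.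
by rewrite expr2 ler_piMl.
Qed.

(** The one-step contraction is iterated from the constant 1, which has norm 1, using
    [1 + q <= expR q]. The assumption [t <= n.+1] keeps the step size below 1. *)
Lemma iter_tilted_step_le : exists2 C, 0 <= C & forall t n x,
  0 <= t -> t <= n.+1%:R ->
  iter n.+1 (tilted_step (t / n.+1%:R)) (fun=> 1) x <=
  expR (- (t * lam) + C * t ^+ 2 / n.+1%:R) / nu x.
Proof.
have [C C0 CP] := tilted_step_contraction.
(* The halving comes from the passage from the squared norm to the norm. *)
exists (C / 2); first by rewrite divr_ge0.
move=> t n x t0 tn; set dl := t / _.
have n0 : 0 < n.+1%:R :> R by rewrite ltr0n.
have dl0 : 0 <= dl by rewrite divr_ge0.
have dl1 : dl <= 1 by rewrite ler_pdivrMr ?mul1r.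
set T := tilted_step dl.
pose q := - 2 * (dl * lam) + C * dl ^+ 2.
have iterP m : inner nu (iter m T (fun=> 1)) (iter m T (fun=> 1)) <= expR (m%:R * q).
  elim: m => [|m IH].
    rewrite mul0r expR0 /inner /= -[leRHS]nu_sum1.
    by apply: ler_sum => y _; rewrite !mul1r.
  rewrite iterS (le_trans (CP _ _ dl0 dl1)) //.
  have -> : m.+1%:R * q = q + m%:R * q by rewrite -nat1r; ring.
  rewrite expRD.
  apply: le_trans (ler_wpM2l (expR_ge0 _) IH).
  rewrite ler_wpM2r ?(inner_ge0 nu_gt0) //.
  by rewrite (le_trans _ (expR_ge1Dx _)) // /q; lra.
rewrite (le_trans (ler_norm _)) // (le_trans (norm_le_norm2 _ _)) //.
rewrite ler_wpM2r ?invr_ge0 ?(ltW (nu_gt0 x)) //.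
rewrite -(ler_pXn2r (n:=2)) ?nnegrE ?sqrtr_ge0 ?expR_ge0 // sqr_norm2.
rewrite (le_trans (iterP _)) // -expRM_natl ler_expR.
rewrite /q /dl le_eqVlt; apply/orP; left; apply/eqP; field.
by rewrite nat1r gt_eqF.
Qed.

End TiltedKernel.

(** * Time integrals along right-continuous paths *)

Section RightRiemannSums.
Context {R : realType}.
Variables (v : R -> R) (t b : R).
Hypothesis t_gt0 : 0 < t.
Hypothesis v_bounded : forall s, `|v s| <= b.
Hypothesis v_right : forall s, 0 <= s -> v u @[u --> s^'+] --> v s.

Local Notation mu := (@lebesgue_measure R).
Let mesh n : R := t / n.+1%:R.
(** The value on a cell is taken at its right endpoint, so that the point sampled for [s] lies at or
    to the right of [s], where right-continuity applies. *)
Let step n (s : R) : R := \sum_(i < n.+1)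
  v (i.+1%:R * mesh n) * \1_(`]i%:R * mesh n, i.+1%:R * mesh n]%classic) s.

Definition right_riemann_sum n : R :=
  t / n.+1%:R * \sum_(i < n.+1) v (i.+1%:R * (t / n.+1%:R)).

Let mesh_gt0 n : 0 < mesh n.
Proof. by rewrite divr_gt0. Qed.

Let mesh_max n : n.+1%:R * mesh n = t.
Proof. by rewrite /mesh mulrC divfK. Qed.

Let measurable_step n D : measurable_fun D (step n).
Proof.
apply: measurable_sum => i; apply: measurable_funM; first exact: measurable_cst.
by apply: measurable_funTS; apply: measurable_indic.
Qed.

(** The sampled point is the first grid point at or after [s]; the cells are disjoint, so a single
    indicator is nonzero. *)
Let stepE n s : 0 < s -> s <= t ->
  exists2 u, s <= u < s + mesh n + mesh n & step n s = v u.
Proof.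
move=> s0 st.
have ex : exists j, s <= j%:R * mesh n by exists n.+1; rewrite mesh_max.
case: (ex_minnP ex) => -[|j] sj jmin; first by rewrite mul0r leNgt s0 in sj.
have js : j%:R * mesh n < s.
  by rewrite ltNge; apply/negP => /jmin; rewrite ltnn.
have jn : (j < n.+1)%N by apply: jmin; rewrite mesh_max.
exists (j.+1%:R * mesh n).
  rewrite sj /= -addn1 natrD mulrDl mul1r ltrD2r.
  by rewrite (lt_trans js) // ltrDl.
rewrite /step (bigD1 (Ordinal jn)) //= big1 ?addr0 => [|i ij].
  by rewrite indicE mem_set ?mulr1 //= in_itv /= js.
rewrite indicE memNset ?mulr0 //= in_itv /= => /andP[lo hi].
have {}ij : i != j :> nat by apply: contra ij => /eqP ij; apply/eqP/val_inj.
case: (ltngtP i j) ij => // ij _.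
  have : i.+1%:R * mesh n <= j%:R * mesh n by rewrite ler_pM2r ?ler_nat.
  by move=> /(le_trans hi); rewrite leNgt js.
have : j.+1%:R * mesh n <= i%:R * mesh n by rewrite ler_pM2r ?ler_nat.
by move=> /(le_trans sj); rewrite leNgt lo.
Qed.

Let step_cvg s : `]0, t]%classic s -> step n s @[n --> \oo] --> v s.
Proof.
rewrite /= in_itv /= => /andP[s0 st].
apply/cvgrPdist_lt => e e0.
have /cvgrPdist_lt/(_ e e0)[r /= r0 rP] := v_right (ltW s0).
have mesh0 : mesh n @[n --> \oo] --> 0.
  by rewrite -(mulr0 t); apply: cvgMl_tmp; exact: cvg_harmonic.
have r20 : 0 < r / 2 by rewrite divr_gt0.
have /cvgrPdist_lt/(_ _ r20) := mesh0.
apply: filterS => n; rewrite sub0r normrN gtr0_norm // => nr.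
have [u /andP[su us] ->] := stepE n s0 st.
(* The filter [s^'+] excludes [s] itself, so a sample falling exactly on [s] is treated apart. *)
have [->|ns] := eqVneq s u; first by rewrite subrr normr0.
apply: rP; last by rewrite lt_neqAle ns.
rewrite /= distrC ger0_norm ?subr_ge0 // ltrBlDl (lt_trans us) //.
by rewrite -addrA ltrD2l [r]splitr ltrD.
Qed.

Let mD : measurable (`]0, t]%classic : set R).
Proof. exact: measurable_itv. Qed.

Let finD : (mu `]0%R, t]%classic < +oo)%E.
Proof. by rewrite lebesgue_measure_itv /= lte_fin t_gt0 -EFinD ltry. Qed.

(** A right-continuous function is the pointwise limit of its step functions, hence measurable. *)
Let measurable_v : measurable_fun `]0, t]%classic v.
Proof. exact: (@measurable_fun_cvg _ _ _ _ step). Qed.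

Let integrable_cst k : mu.-integrable `]0, t]%classic (EFin \o cst k).
Proof.
apply: measurable_bounded_integrable => //.
by exists `|k|; split => // M kM s _; exact: ltW.
Qed.

Lemma right_continuous_integrable : mu.-integrable `[0, t] (EFin \o v).
Proof.
apply: measurable_bounded_integrable => //.
- by rewrite /= lebesgue_measure_itv /= lte_fin t_gt0 -EFinD ltry.
- by apply/measurable_fun_itv_obnd_cbndP.
- exists b; split; first by rewrite num_real.
  by move=> M bM s _ /=; rewrite (le_trans (v_bounded s)) // ltW.
Qed.

Let integral_step n : (\int[mu]_(s in `]0%R, t]) (step n s)%:E =
  (right_riemann_sum n)%:E)%E.
Proof.
rewrite /step; under eq_integral do rewrite -sumEFin.
rewrite integral_sum //= => [|i]; last first.
  apply: measurable_bounded_integrable => //.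
    apply: measurable_funM; first exact: measurable_cst.
    by apply: measurable_funTS; apply: measurable_indic.
  exists b; split; first by rewrite num_real.
  move=> M bM s _ /=; rewrite (le_trans _ (ltW bM)) // normrM.
  rewrite (le_trans _ (v_bounded (i.+1%:R * mesh n))) //
    ler_piMr // indicE.
  by case: (_ \in _); rewrite ?normr1 ?normr0.
rewrite /right_riemann_sum mulr_sumr -sumEFin; apply: eq_bigr => i _.
under eq_integral do rewrite EFinM.
rewrite integralZl //=; last first.
  apply: (integrableS measurableT) => //; apply: integrable_indic_itv.
rewrite integral_indic // setIidl; last first.
  move=> s /=; rewrite !in_itv /= => /andP[lo hi]; apply/andP; split.
    by rewrite (le_lt_trans _ lo) // mulr_ge0 // ltW.
  by rewrite (le_trans hi) // -[leRHS](mesh_max n) ler_pM2r // ler_nat.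
rewrite /= lebesgue_measure_itv /= lte_fin ltr_pM2r // ltr_nat ltnSn -EFinD -EFinM.
by congr EFin; rewrite -[i.+1%:R]natr1 /mesh; ring.
Qed.

(** Dominated convergence for the step functions, all bounded by [b]; the endpoint 0 has measure
    zero. *)
Lemma right_riemann_sum_cvg :
  right_riemann_sum n @[n --> \oo] --> \int[mu]_(s in `[0, t]) v s.
Proof.
rewrite -Rintegral_itv_obnd_cbnd; last first.
  by apply: integrableS right_continuous_integrable => //; exact: subset_itv_oc_cc.
have /fine_cvg : ((right_riemann_sum n)%:E @[n --> \oo] -->
    (\int[mu]_(s in `]0%R, t]) v s)%:E)%E.
  rewrite /Rintegral fineK; last first.
    apply: integrable_fin_num => //.
    by apply: integrableS right_continuous_integrable => //; exact: subset_itv_oc_cc.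
  under eq_fun do rewrite -integral_step.
  apply: (@dominated_cvg _ _ _ mu _ mD _ _ (EFin \o cst b)) => //.
  - by move=> n; have /measurable_EFinP := @measurable_step n `]0, t]%classic.
  - by move=> s Ds; apply/fine_cvgP; split; [exact: nearW|exact: step_cvg].
  - move=> n s; rewrite /= in_itv /= => /andP[s0 st].
    by have [u _ ->] := stepE n s0 st; rewrite lee_fin.
by apply.
Qed.

End RightRiemannSums.

(** * Exponential moments of additive functionals *)

Section MarkovChain.
Context {R : realType} {S : finType} d (Omega : measurableType d).
Variables (M : S -> S -> R) (P : S -> probability Omega R) (X : R -> Omega -> S).
Hypothesis chain : markov_chain M P X.

Lemma measurable_observable (v : S -> R) s : 0 <= s ->
  measurable_fun setT (fun omega => v (X s omega)).
Proof.
move=> s0 _ Y mY; rewrite setTI.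
have -> : (fun omega => v (X s omega)) @^-1` Y =
    \bigcup_(y in [set y | Y (v y)]) (X s @^-1` [set y]).
  by apply/seteqP; split => [om Yv|om [y Yv /= Xy]]; [exists (X s om)|rewrite /= Xy].
by apply: fin_bigcup_measurable => // y _; case: chain => + _ _; apply.
Qed.

Lemma measurable_cylinder n (ts : nat -> R) (ys : nat -> S) :
  (forall i, 0 <= ts i) ->
  measurable [set omega | forall i, (i <= n)%N -> X (ts i) omega = ys i].
Proof.
move=> ts0.
have -> : [set omega | forall i, (i <= n)%N -> X (ts i) omega = ys i] =
  \bigcap_(i in [set i | (i <= n)%N]) (X (ts i) @^-1` [set ys i]).
  by apply/seteqP; split => om.
apply: bigcap_measurable => [|i _]; first by exists 0%N.
by case: chain => + _ _; apply.
Qed.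

(** Total expectation over the finitely many values of [Z]. *)
Lemma integral_split (p : probability Omega R) (E : set Omega)
    (Z : Omega -> S) (F : Omega -> R) :
  measurable E -> (forall y, measurable (Z @^-1` [set y])) ->
  measurable_fun setT F -> (forall omega, 0 <= F omega) ->
  (\int[p]_(omega in E) (F omega)%:E =
   \sum_(y : S) \int[p]_(omega in E `&` Z @^-1` [set y]) (F omega)%:E)%E.
Proof.
move=> mE mZ mF F0.
have EU : E = \big[setU/set0]_(y : S) (E `&` Z @^-1` [set y]).
  apply/seteqP; split => [om Eom|om].
    by rewrite -bigcup_seq; exists (Z om) => //=; rewrite mem_index_enum.
  by rewrite -bigcup_seq => -[y _ []].
rewrite {1}EU ge0_integral_bigsetU //.
- by move=> y; exact: measurableI.
- exact: index_enum_uniq.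
- by move=> y z _ _ [om [[_ /= <-] [_ /= <-]]].
- by apply: measurable_funTS; exact/measurable_EFinP.
- by move=> om _; rewrite lee_fin.
Qed.

Variables (h : S -> R) (dl : R).
Hypothesis dl_ge0 : 0 <= dl.

Let grid i : R := i%:R * dl.
Let grid_ge0 i : 0 <= grid i. Proof. by rewrite mulr_ge0. Qed.
(** Feynman-Kac weight of the [m] grid times that follow index [k]. Fixing one more position of the
    path raises [k] and lowers [m]. *)
Let tilt k m omega : R :=
  \prod_(j < m) expR (dl * h (X (grid (k + j).+1) omega)).

Let tilt_ge0 k m omega : 0 <= tilt k m omega.
Proof. by apply: prodr_ge0 => j _; exact: expR_ge0. Qed.

Let measurable_tilt k m : measurable_fun setT (tilt k m).
Proof.
apply: measurable_prod => j _.
exact: (@measurable_observable (fun y => expR (dl * h y))).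
Qed.

(** Discrete Feynman-Kac formula, by induction on [m] for all prescribed paths [ys]. Splitting
    according to the next position [z] lengthens the cylinder by one time and makes the first weight
    constant; when no weight is left, the finite-dimensional distributions give the value. *)
Let cylinder_integral x m k (ys : nat -> S) :
  (\int[P x]_(omega in [set omega | forall i, (i <= k)%N -> X (grid i) omega = ys i])
      (tilt k m omega)%:E =
   ((ys 0%N == x)%:R * \prod_(i < k) semigroup M dl (ys i) (ys i.+1)
    * iter m (tilted_step M h dl) (fun=> 1) (ys k))%:E)%E.
Proof.
elim: m k ys => [k ys|m IH k ys].
  rewrite /= mulr1 /tilt; under eq_integral do rewrite big_ord0.
  rewrite integral_cst ?mul1e; last exact: measurable_cylinder.
  have fdd : P x [set omega | forall i, (i <= k)%N -> X (grid i) omega = ys i] =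
      ((ys 0%N == x)%:R *
       \prod_(i < k) semigroup M (grid i.+1 - grid i) (ys i) (ys i.+1))%:E.
    case: chain => _ _; apply; first by rewrite /grid mul0r.
    by move=> i j ij; rewrite /grid ler_wpM2r // ler_nat.
  apply: (etrans fdd); congr (_ * _)%:E; apply: eq_bigr => i _; congr semigroup.
  by rewrite /grid -natr1; ring.
(* The prescribed path extended by [z] at index [k.+1]. *)
pose yz z i := if i == k.+1 then z else ys i.
rewrite (@integral_split _ _ (X (grid k.+1))) //; first last.
- by move=> y; case: chain => + _ _; apply.
- exact: measurable_cylinder.
rewrite iterS /tilted_step -/(tilted_step M h dl) mulr_sumr -sumEFin.
apply: eq_bigr => z _.
have -> : [set omega | forall i, (i <= k)%N -> X (grid i) omega = ys i] `&`
    X (grid k.+1) @^-1` [set z] =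
    [set omega | forall i, (i <= k.+1)%N -> X (grid i) omega = yz z i].
  apply/seteqP; split => om /=.
    move=> [h1 h2] i; rewrite leq_eqVlt /yz => /predU1P[->|ik]; first by rewrite eqxx.
    by rewrite ltn_eqF //; exact: h1.
  move=> h1; split; last by rewrite h1 // /yz eqxx.
  by move=> i ik; rewrite h1 ?(leq_trans ik) // /yz ltn_eqF.
transitivity (\int[P x]_(omega in [set omega | forall i, (i <= k.+1)%N ->
     X (grid i) omega = yz z i]) ((expR (dl * h z))%:E * (tilt k.+1 m omega)%:E))%E.
  apply: eq_integral => om; rewrite inE /= => h1.
  rewrite -EFinM /tilt big_ord_recl /= addn0 h1 // /yz eqxx.
  congr (_ * _)%:E; apply: eq_bigr => j _; congr (expR (_ * h (X (grid _) _))).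
  by rewrite /= /bump /= addnA addn1.
rewrite ge0_integralZl ?lee_fin ?expR_ge0 //; first last.
- by move=> om _; rewrite lee_fin.
- by apply: measurable_funTS; exact/measurable_EFinP.
- exact: measurable_cylinder.
rewrite IH -EFinM; congr EFin.
rewrite big_ord_recr /= /yz eqxx (ltn_eqF (ltnSn k)) /=.
rewrite (eq_bigr (fun i : 'I_k => semigroup M dl (ys i) (ys i.+1))) => [|i _].
  ring.
by rewrite !ltn_eqF ?ltnS // ltnW // ltnS.
Qed.

(** The case [k = 0] of the cylinder formula, summed over the initial position; only the starting
    point [x] contributes. *)
Lemma expectation_tilt x n :
  (\int[P x]_omega
     (expR (dl * \sum_(i < n) h (X (i.+1%:R * dl) omega)))%:E =
   (iter n (tilted_step M h dl) (fun=> 1) x)%:E)%E.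
Proof.
transitivity (\int[P x]_omega (tilt 0 n omega)%:E)%E.
  apply: eq_integral => om _; congr EFin.
  by rewrite mulr_sumr expR_sum; apply: eq_bigr => i _; rewrite add0n.
rewrite (@integral_split _ _ (X (grid 0))) //; last first.
  by move=> y; case: chain => + _ _; apply.
rewrite (bigD1 x) //= [X in (_ + X)%E]big1 ?adde0 => [|y yx].
- have := cylinder_integral x n 0 (fun=> x); rewrite big_ord0 eqxx !mul1r => <-.
  congr integral; apply/seteqP; split => om /=; last by move=> ->.
  by move=> [_ <-] i; rewrite leqn0 => /eqP ->.
- have := cylinder_integral x n 0 (fun=> y).
  rewrite big_ord0 (negbTE yx) !mul0r => e; rewrite -[RHS]e.
  congr integral; apply/seteqP; split => om /=; last by move=> ->.
  by move=> [_ <-] i; rewrite leqn0 => /eqP ->.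
Qed.

End MarkovChain.

(** * Exponential tail bound for time integrals along the chain *)

Section AdditiveFunctional.
Context {R : realType} {S : finType} d (Omega : measurableType d).
Variables (M : S -> S -> R) (P : S -> probability Omega R) (X : R -> Omega -> S).
Hypothesis chain : markov_chain M P X.
Local Notation mu := (@lebesgue_measure R).

Definition additive_functional (h : S -> R) (t : R) (omega : Omega) : R :=
  \int[mu]_(s in `[0, t]) h (X s omega).

Lemma observable_right_continuous (h : S -> R) omega s : 0 <= s ->
  h (X u omega) @[u --> s^'+] --> h (X s omega).
Proof.
move=> s0; apply: cvg_near_cst.
by case: chain => _ /(_ omega s s0) + _; apply: filterS => u ->.
Qed.

Lemma observable_integrable (h : S -> R) omega t : 0 < t ->
  mu.-integrable `[0, t] (fun s => (h (X s omega))%:E).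
Proof.
move=> t0; apply: (@right_continuous_integrable _ (fun s => h (X s omega))
  t (\sum_y `|h y|)) => // s; first exact: norm_le_sum_norm.
exact: observable_right_continuous.
Qed.

Lemma additive_functional_cvg (h : S -> R) t omega : 0 < t ->
  t / n.+1%:R * \sum_(i < n.+1) h (X (i.+1%:R * (t / n.+1%:R)) omega)
    @[n --> \oo] --> additive_functional h t omega.
Proof.
move=> t0; apply: (@right_riemann_sum_cvg _ (fun s => h (X s omega))
  t (\sum_y `|h y|)) => // s; first exact: norm_le_sum_norm.
exact: observable_right_continuous.
Qed.

Let measurable_riemann (h : S -> R) t n : 0 < t -> measurable_fun setT
  (fun om => t / n.+1%:R * \sum_(i < n.+1) h (X (i.+1%:R * (t / n.+1%:R)) om)).
Proof.
move=> t0; apply: measurable_funM; first exact: measurable_cst.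
apply: measurable_sum => i; apply: (measurable_observable chain).
by rewrite mulr_ge0 // divr_ge0 // ltW.
Qed.

Lemma measurable_additive_functional (h : S -> R) t : 0 < t ->
  measurable_fun setT (additive_functional h t).
Proof.
move=> t0; apply: (@measurable_fun_cvg _ _ _ _ _ _
  (fun n => measurable_riemann h n t0)) => omega _.
exact: additive_functional_cvg.
Qed.

Lemma measurable_additive_functional_ge0 (h : S -> R) t : 0 < t ->
  measurable [set omega | 0 <= additive_functional h t omega].
Proof.
move=> t0.
have := measurable_additive_functional h t0 measurableT (measurable_itv `[0, +oo[).
rewrite setTI; congr (measurable _); apply/seteqP.
by split => om /=; rewrite in_itv /= andbT.
Qed.

Variables (nu h : S -> R) (lam : R).
Hypothesis nu_gt0 : forall x, 0 < nu x.
Hypothesis nu_sum1 : \sum_x nu x = 1.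
Hypothesis form_le : forall u : S -> R,
  inner nu (fun x => apply_gen M u x + h x * u x) u <= - lam * inner nu u u.

(** Markov's inequality for the exponential of the functional. The moment is the limit of those of
    the Riemann sums, by dominated convergence, and the discretization error [C * t ^+ 2 / n.+1]
    vanishes in the limit. *)
Lemma additive_functional_tail t x : 0 < t ->
  (P x [set omega | (0 <= additive_functional h t omega)%R]
   <= (expR (- (t * lam)) / nu x)%:E)%E.
Proof.
move=> t0.
pose A := additive_functional h t.
pose An n om := t / n.+1%:R * \sum_(i < n.+1) h (X (i.+1%:R * (t / n.+1%:R)) om).
have mA := measurable_additive_functional h t0.
have mE := measurable_additive_functional_ge0 h t0.
pose b := \sum_y `|h y|.
(* A bound uniform in [n] and in the path, which supplies the dominating constant. *)
have An_le n om : An n om <= t * b.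
  rewrite /An -mulrA ler_wpM2l ?(ltW t0) // mulrC ler_pdivrMr // mulr_natr.
  have -> : b *+ n.+1 = \sum_(i < n.+1) b by rewrite sumr_const card_ord.
  apply: ler_sum => i _.
  exact: le_trans (ler_norm _) (norm_le_sum_norm _ _).
have tail_le : (P x [set omega | (0 <= A omega)%R] <=
    \int[P x]_omega (expR (A omega))%:E)%E.
  have := integral_indic (P x) measurableT mE; rewrite setIT => e.
  apply: (@le_trans _ _ (\int[P x]_omega
     (\1_[set omega | (0 <= A omega)%R] omega)%:E)%E); first by rewrite e.
  apply: ge0_le_integral => //.
  - by apply/measurable_EFinP/measurable_indic.
  - by apply/measurable_EFinP; apply: measurableT_comp mA; exact: measurable_expR.
  - move=> om _; rewrite lee_fin indicE; case: (boolP (_ \in _)) => [|_]; last exact: expR_ge0.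
    by rewrite inE /= => A0; rewrite -expR0 ler_expR.
apply: (le_trans tail_le).
have lim1 : (\int[P x]_omega (expR (An n omega))%:E @[n --> \oo] -->
    \int[P x]_omega (expR (A omega))%:E)%E.
  apply: (@dominated_cvg _ _ _ (P x) _ measurableT _ _ (EFin \o cst (expR (t * b)))) => //.
  - move=> n; apply/measurable_EFinP; apply: measurableT_comp; first exact: measurable_expR.
    exact: measurable_riemann.
  - move=> om _; apply/fine_cvgP; split; first exact: nearW.
    apply: (@continuous_cvg _ _ _ _ _ _ expR); first exact: continuous_expR.
    exact: additive_functional_cvg.
  - exact: finite_measure_integrable_cst.
  - by move=> n om _; rewrite /= lee_fin ger0_norm ?expR_ge0 // ler_expR.
have [C C0 CP] := iter_tilted_step_le nu_gt0 nu_sum1 form_le.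
have lim2 : (expR (- (t * lam) + C * t ^+ 2 / n.+1%:R) / nu x)%:E @[n --> \oo] -->
    (expR (- (t * lam)) / nu x)%:E.
  apply/fine_cvgP; split; first exact: nearW.
  apply: cvgMr_tmp.
  apply: (@continuous_cvg _ _ _ _ _ _ expR); first exact: continuous_expR.
  rewrite -[X in _ --> X]addr0; apply: cvgD; first exact: cvg_cst.
  by rewrite -(mulr0 (C * t ^+ 2)); apply: cvgMl_tmp; exact: cvg_harmonic.
apply: (lee_cvg_to lim1 lim2).
near=> n.
have -> : (\int[P x]_omega (expR (An n omega))%:E =
    (iter n.+1 (tilted_step M h (t / n.+1%:R)) (fun=> 1) x)%:E)%E.
  apply: (expectation_tilt chain); by rewrite divr_ge0 // ltW.
rewrite lee_fin; apply: CP; first exact: ltW.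
(* For large [n] the step size [t / n.+1] is at most 1, as the contraction requires. *)
near: n; apply: filterS (nbhs_infty_ger t) => n /le_trans; apply.
by rewrite ler_nat.
Unshelve. all: by end_near.
Qed.

End AdditiveFunctional.

(** * Extrema of functions on a finite set *)

Section FiniteRange.
Context {R : realType} {S : finType}.
Implicit Types (F : S -> R) (x : S).

Lemma has_ubound_range F : has_ubound (range F).
Proof.
exists (\sum_y `|F y|) => _ [x _ <-].
exact: le_trans (ler_norm _) (norm_le_sum_norm _ _).
Qed.

Lemma le_sup_range F x : F x <= sup (range F).
Proof. by apply: ub_le_sup; [exact: has_ubound_range|exists x]. Qed.

Lemma has_lbound_range F : has_lbound (range F).
Proof.
exists (- \sum_y `|F y|) => _ [x _ <-].
rewrite lerNl (le_trans (ler_norm _)) // normrN; exact: norm_le_sum_norm.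
Qed.

Lemma inf_range_le F x : inf (range F) <= F x.
Proof. by apply: ge_inf; [exact: has_lbound_range|exists x]. Qed.

Lemma le_inf_range F b : (0 < #|S|)%N -> (forall x, b <= F x) -> b <= inf (range F).
Proof.
move=> /card_gt0P[x _] bF; apply: lb_le_inf; first by exists (F x), x.
by move=> _ [y _ <-].
Qed.

Lemma inf_range_attained F : (0 < #|S|)%N -> exists x, inf (range F) = F x.
Proof.
move=> /card_gt0P[x0 _].
have [x _ xmin] := @Order.TotalTheory.arg_minP _ _ S x0 predT F isT.
exists x; apply/eqP; rewrite eq_le inf_range_le /=.
by apply: le_inf_range; [apply/card_gt0P; exists x0|move=> y; exact: xmin].
Qed.

End FiniteRange.

(** * Linearity and positivity of time integrals *)

Section AdditiveFunctionalTheory.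
Context {R : realType} {S : finType} d (Omega : measurableType d).
Variables (M : S -> S -> R) (P : S -> probability Omega R) (X : R -> Omega -> S).
Hypothesis chain : markov_chain M P X.

Lemma additive_functional_linear (k l : R) (u v : S -> R) t omega : 0 < t ->
  additive_functional X (fun x => k * u x + l * v x) t omega =
  k * additive_functional X u t omega + l * additive_functional X v t omega.
Proof.
move=> t0; have iu := observable_integrable chain u omega t0.
have iv := observable_integrable chain v omega t0.
have iku := observable_integrable chain (fun x => k * u x) omega t0.
have ilv := observable_integrable chain (fun x => l * v x) omega t0.
by rewrite /additive_functional RintegralD // !RintegralZl.
Qed.

Lemma additive_functional_gt0 (v : S -> R) t omega : (forall x, 0 < v x) ->
  0 < t -> 0 < additive_functional X v t omega.
Proof.
move=> v0 t0; have S0 : (0 < #|S|)%N by apply/card_gt0P; exists (X 0 omega).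
have [x0 infE] := inf_range_attained v S0.
apply: (@lt_le_trans _ _ (\int[lebesgue_measure]_(s in `[0, t]) v x0)).
  rewrite Rintegral_cst // /= lebesgue_measure_itv /= lte_fin t0 /= subr0.
  exact: mulr_gt0.
rewrite /additive_functional; apply: le_Rintegral => //.
- exact: (observable_integrable chain (fun=> v x0) omega t0).
- exact: (observable_integrable chain v omega t0).
- by move=> s _; rewrite -infE inf_range_le.
Qed.

End AdditiveFunctionalTheory.

(** * The Metropolis chain and the quadratic form of its tilt *)

Section Metropolis.
Context {R : realType} {S : finType}.
Variables (Q : S -> S -> R) (E : S -> R).

Lemma partition_fun_gt0 : (0 < #|S|)%N -> 0 < partition_fun E.
Proof.
move=> /card_gt0P[x _]; rewrite /partition_fun (bigD1 x) //=.
by rewrite ltr_pwDl ?expR_gt0 // sumr_ge0 // => y _; exact: expR_ge0.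
Qed.

Lemma gibbs_gt0 x : 0 < gibbs E x.
Proof.
by rewrite divr_gt0 ?expR_gt0 // partition_fun_gt0 //; apply/card_gt0P; exists x.
Qed.

Lemma gibbs_sum1 : (0 < #|S|)%N -> \sum_x gibbs E x = 1.
Proof. by move=> S0; rewrite -mulr_suml mulfV // gt_eqF // partition_fun_gt0. Qed.

Lemma metropolisE x y : x != y ->
  metropolis Q E x y = Q x y * expR (- Num.max (E y - E x) 0).
Proof. by rewrite /metropolis => /negbTE ->. Qed.

Lemma metropolis_generator : is_generator Q -> is_generator (metropolis Q E).
Proof.
move=> [Q0 _]; split => [x y xy|x].
  by rewrite metropolisE // mulr_ge0 ?expR_ge0 ?Q0.
rewrite (bigD1 x) //= {1}/metropolis eqxx addrC; apply/eqP; rewrite subr_eq0.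
by apply/eqP; apply: eq_bigr => y yx; rewrite metropolisE // eq_sym.
Qed.

(** Both sides carry the exponent [- max (E x) (E y)], which is symmetric in [x] and [y]. *)
Lemma metropolis_reversible : symmetric_rates Q -> forall x y,
  gibbs E x * metropolis Q E x y = gibbs E y * metropolis Q E y x.
Proof.
move=> Qs x y; have [->//|xy] := eqVneq x y.
rewrite !metropolisE // 1?eq_sym // Qs /gibbs.
suff : expR (- E x) * expR (- Num.max (E y - E x) 0) =
       expR (- E y) * expR (- Num.max (E x - E y) 0).
  move=> e.
  transitivity (Q y x / partition_fun E *
    (expR (- E x) * expR (- Num.max (E y - E x) 0))); first ring.
  by rewrite e; ring.
rewrite -!expRD; congr expR.
by rewrite /Num.max; case: ifPn; case: ifPn; rewrite -?leNgt; lra.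
Qed.

Lemma metropolis_irreducible : irreducible_rates Q ->
  irreducible_rates (metropolis Q E).
Proof.
move=> Qirr x y; move: (Qirr x y); apply: connect_sub => u v /andP[uv Quv].
by apply: connect1; rewrite /= uv metropolisE // mulr_gt0 ?expR_gt0.
Qed.

End Metropolis.

(** * Quadratic form of the tilted generator *)

Section TiltedForm.
Context {R : realType} {S : finType}.
Variables (M : S -> S -> R) (nu : S -> R).
Hypothesis nu_gt0 : forall x, 0 < nu x.
Hypothesis nu_sum1 : \sum_x nu x = 1.
Hypothesis M_gen : is_generator M.
Hypothesis M_rev : forall x y, nu x * M x y = nu y * M y x.
Local Notation gap := (spectral_gap M nu).
Hypothesis gap_gt0 : 0 < gap.

Let inner_sub_cst (v u : S -> R) b :
  inner nu v u = b * mean nu v + inner nu v (fun x => u x - b).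
Proof.
rewrite /inner /mean mulr_sumr -big_split; apply: eq_bigr => x _ /=; ring.
Qed.

Let innerC (v u : S -> R) : inner nu v u = inner nu u v.
Proof. by apply: eq_bigr => x _; rewrite [v x * _]mulrC. Qed.

(** Take [b] to be the mean of [u]. Constants are killed by [M] and orthogonal to its range, so the
    form only sees the fluctuation [psi], to which the spectral gap applies. *)
Lemma form_centered (u : S -> R) : exists b psi,
  [/\ forall x, u x = b + psi x,
      inner nu u u = b ^+ 2 + inner nu psi psi &
      inner nu (apply_gen M u) u <= - gap * inner nu psi psi].
Proof.
pose b := mean nu u; pose psi x := u x - b; exists b, psi.
have psi0 : mean nu psi = 0.
  rewrite /mean /psi; under eq_bigr do rewrite mulrBl.
  by rewrite sumrB -mulr_sumr nu_sum1 mulr1 subrr.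
have uE : u = (fun x => b + psi x) by apply/funext => x; rewrite /psi addrC subrK.
split; first by rewrite {1}uE.
  rewrite (inner_sub_cst u u b) innerC (inner_sub_cst (fun x => u x - b) u b) -/psi.
  by rewrite psi0 mulr0 add0r -/b expr2.
have -> : inner nu (apply_gen M u) u = - inner nu (fun x => - apply_gen M psi x) psi.
  rewrite (inner_sub_cst (apply_gen M u) u b) -/psi.
  have -> : apply_gen M u = apply_gen M psi.
    by rewrite {1}uE (apply_gen_shift M_gen).
  rewrite (apply_gen_stationary M_gen M_rev) mulr0 add0r /inner -sumrN.
  by apply: eq_bigr => x _; ring.
by rewrite mulNr lerN2; exact: spectral_gap_le.
Qed.

Variables (rho g : S -> R) (K a eta : R).
Hypothesis rho_ge0 : forall x, 0 <= rho x.
Hypothesis rho_le : forall x, rho x <= K.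
Hypothesis rho_mean : mean nu rho = 1.
Hypothesis a_gt0 : 0 < a.
Hypothesis g_le : forall x, `|g x| <= a.
Hypothesis eta_gt0 : 0 < eta.
Hypothesis eta_le : eta <= 2 * a.

(** With [rho] as the density of the target with respect to [nu], [m] is the target mean of [g]. *)
Let m := mean nu (fun x => rho x * g x).
Let h x := rho x * (g x - m - eta).

Let K_ge1 : 1 <= K.
Proof. by rewrite -rho_mean; exact: (mean_le_sup nu_gt0 nu_sum1). Qed.

Let m_ge : - a <= m.
Proof.
suff : - m <= a by rewrite lerNl.
rewrite -[a]mulr1 -rho_mean /m /mean mulr_sumr -sumrN; apply: ler_sum => x _.
rewrite mulrA -mulNr ler_wpM2r ?(ltW (nu_gt0 x)) // -mulrN mulrC ler_wpM2r //.
by rewrite (le_trans (ler_norm _)) // normrN.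
Qed.

Let h_mean : mean nu h = - eta.
Proof.
have mean1 k : mean nu (fun x => rho x * (g x - k - eta)) =
    mean nu (fun x => rho x * g x) - (k + eta) * mean nu rho.
  by rewrite /mean mulr_sumr -sumrB; apply: eq_bigr => x _; ring.
by rewrite mean1 rho_mean -/m; ring.
Qed.

Let h_le x : h x <= 2 * a * K.
Proof.
have := rho_ge0 x; have := rho_le x; have := g_le x; rewrite ler_norml => /andP[_ ga] rK r0.
rewrite /h mulrC; apply: (@le_trans _ _ (2 * a * rho x)).
  rewrite ler_wpM2r //; have mg := m_ge; have e0 := eta_gt0; move: (m) mg => k mg; lra.
by rewrite ler_wpM2l // mulr_ge0 // ltW.
Qed.

(** One factor [rho] is bounded by [K]; under the density [rho], the remaining second moment is the
    variance of [g] plus [eta ^+ 2]. *)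
Let h2_mean : mean nu (fun x => h x ^+ 2) <= K * (a ^+ 2 + eta ^+ 2).
Proof.
have K0 : 0 <= K by exact: le_trans K_ge1.
apply: (@le_trans _ _ (K * mean nu (fun x => rho x * (g x - m - eta) ^+ 2))).
  rewrite /mean mulr_sumr; apply: ler_sum => x _.
  rewrite mulrA ler_wpM2r ?(ltW (nu_gt0 x)) // /h exprMn mulrA.
  by rewrite ler_wpM2r ?sqr_ge0 // expr2 ler_wpM2r.
rewrite ler_wpM2l //.
have mean2 k : mean nu (fun x => rho x * (g x - k - eta) ^+ 2) =
    mean nu (fun x => rho x * g x ^+ 2)
    - 2 * (k + eta) * mean nu (fun x => rho x * g x) + (k + eta) ^+ 2 * mean nu rho.
  rewrite /mean !mulr_sumr -sumrB -big_split.
  by apply: eq_bigr => x _ /=; ring.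
rewrite mean2 -/m.
have : mean nu (fun x => rho x * g x ^+ 2) <= a ^+ 2 * mean nu rho.
  rewrite /mean mulr_sumr; apply: ler_sum => x _.
  rewrite mulrA ler_wpM2r ?(ltW (nu_gt0 x)) // mulrC ler_wpM2r //.
  by rewrite -real_normK ?num_real // ler_pXn2r ?nnegrE // ltW.
rewrite rho_mean; have := sqr_ge0 m; nra.
Qed.

Let lam := gap * eta ^+ 2 / (32 * a ^+ 2 * K).

(** The mean of [h] contributes [- 2 lam b^2], of which the cross term consumes [lam b^2]. On the
    fluctuation the gap must absorb the rest of the cross term, the upper bound [2 * a * K] of [h],
    and [lam] itself; this is the inequality [scalar]. *)
Lemma tilted_form_le (u : S -> R) :
  inner nu (fun x => apply_gen M u x
     + (2 * lam / eta * h x) * u x) u <= - lam * inner nu u u.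
Proof.
have [b [psi [uE uu Mu]]] := form_centered u.
have K0 : 0 < K by exact: lt_le_trans K_ge1.
have lam0 : 0 < lam by rewrite divr_gt0 ?mulr_gt0 ?exprn_gt0.
pose s2 := K * (a ^+ 2 + eta ^+ 2).
have s20 : 0 < s2 by rewrite mulr_gt0 // addr_gt0 ?exprn_gt0.
pose th := 2 * lam / eta.
have th0 : 0 < th by apply: divr_gt0 => //; exact: mulr_gt0.
have psi2 : 0 <= inner nu psi psi by exact: inner_ge0.
(* AM-GM for the cross term: [2 th b h psi <= (lam/s2) b^2 h^2 + (th^2 s2/lam) psi^2] *)
have cross : 2 * th * b * mean nu (fun x => h x * psi x) <=
   lam * b ^+ 2 + th ^+ 2 * s2 / lam * inner nu psi psi.
  apply: (@le_trans _ _ (lam / s2 * b ^+ 2 * mean nu (fun x => h x ^+ 2)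
    + th ^+ 2 * s2 / lam * inner nu psi psi)).
    rewrite /mean /inner !mulr_sumr -big_split; apply: ler_sum => x _ /=.
    rewrite -subr_ge0.
    have -> : lam / s2 * b ^+ 2 * (h x ^+ 2 * nu x)
        + th ^+ 2 * s2 / lam * (psi x * psi x * nu x)
        - 2 * th * b * (h x * psi x * nu x) =
        s2 / lam * (lam / s2 * b * h x - th * psi x) ^+ 2 * nu x.
      by field; rewrite !gt_eqF.
    apply: mulr_ge0; last exact: ltW.
    by rewrite mulr_ge0 ?sqr_ge0 // divr_ge0 // ltW.
  rewrite lerD2r.
  have -> : lam * b ^+ 2 = lam / s2 * b ^+ 2 * s2 by field; rewrite gt_eqF.
  by rewrite ler_wpM2l // mulr_ge0 ?sqr_ge0 // divr_ge0 // ltW.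
have sup_term : mean nu (fun x => h x * psi x ^+ 2) <= 2 * a * K * inner nu psi psi.
  rewrite /mean /inner mulr_sumr; apply: ler_sum => x _.
  rewrite mulrA ler_wpM2r ?(ltW (nu_gt0 x)) // -expr2 ler_wpM2r ?sqr_ge0 //.
have -> : inner nu (fun x => apply_gen M u x + (2 * lam / eta * h x) * u x) u =
  inner nu (apply_gen M u) u + th * (b ^+ 2 * mean nu h)
  + 2 * th * b * mean nu (fun x => h x * psi x) + th * mean nu (fun x => h x * psi x ^+ 2).
  rewrite /inner /mean !mulr_sumr -!big_split; apply: eq_bigr => x _ /=.
  by rewrite uE -/th; ring.
rewrite h_mean uu.
have the : th * (b ^+ 2 * - eta) = - 2 * lam * b ^+ 2.
  by rewrite /th; field; rewrite gt_eqF.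
have scalar : - gap + th ^+ 2 * s2 / lam + th * (2 * a * K) <= - lam.
  have -> : th ^+ 2 * s2 / lam = gap * ((a ^+ 2 + eta ^+ 2) / (8 * a ^+ 2)).
    by rewrite /th /s2 /lam; field; rewrite !gt_eqF.
  have -> : th * (2 * a * K) = gap * (eta / (8 * a)).
    by rewrite /th /lam; field; rewrite !gt_eqF.
  have lamle : lam <= gap * (eta ^+ 2 / (32 * a ^+ 2)).
    have -> : lam = gap * (eta ^+ 2 / (32 * a ^+ 2)) / K.
      by rewrite /lam; field; rewrite !gt_eqF.
    rewrite ler_pdivrMr // ler_peMr // mulr_ge0 ?(ltW gap_gt0) //.
    by apply: divr_ge0; [exact: sqr_ge0|apply: mulr_ge0 => //; exact: sqr_ge0].
  have : (a ^+ 2 + eta ^+ 2) / (8 * a ^+ 2) + eta / (8 * a) + eta ^+ 2 / (32 * a ^+ 2) <= 1.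
    have -> : (a ^+ 2 + eta ^+ 2) / (8 * a ^+ 2) + eta / (8 * a) + eta ^+ 2 / (32 * a ^+ 2)
      = (4 * a ^+ 2 + 5 * eta ^+ 2 + 4 * eta * a) / (32 * a ^+ 2).
      by field; rewrite gt_eqF.
    rewrite ler_pdivrMr ?mulr_gt0 ?exprn_gt0 // mul1r.
    (* [28 a^2 - 4 a eta - 5 eta^2 = (2 a - eta) (14 a + 5 eta)]: the constant 32 is exhausted
       exactly at [eta = 2 a]. *)
    have f1 : 0 <= 2 * a - eta by rewrite subr_ge0.
    have f2 : 0 <= 14 * a + 5 * eta by rewrite addr_ge0 // mulr_ge0 // ltW.
    have := mulr_ge0 f1 f2; lra.
  by move=> /(ler_wpM2l (ltW gap_gt0)); rewrite mulr1; lra.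
have := ler_wpM2r psi2 scalar; have := ler_wpM2l (ltW th0) sup_term.
by rewrite the; lra.
Qed.

End TiltedForm.

(** * Landscape modification *)

Section LandscapeModification.
Context {R : realType} {S : finType}.
Variables (H : S -> R) (f : R -> R) (alpha c : R).
Hypothesis S_gt0 : (0 < #|S|)%N.
Hypothesis hyp : standing_assumption H f alpha c.

Let slope u := (alpha * f (Num.max (u - c) 0) + 1)^-1.

Let denom_ge1 u : 1 <= alpha * f (Num.max (u - c) 0) + 1.
Proof.
case: hyp => _ f0 _ _ [_ a0].
by rewrite lerDr mulr_ge0 // f0 // le_max lexx orbT.
Qed.

Let slope_ge0 u : 0 <= slope u.
Proof. by rewrite invr_ge0 (le_trans _ (denom_ge1 u)). Qed.

Let slope_le1 u : slope u <= 1.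
Proof. by rewrite invf_le1 // (lt_le_trans ltr01). Qed.

(** Monotonicity yields the measurability of the integrand of [modified_H]. *)
Let slope_decreasing : nonincreasing_fun slope.
Proof.
move=> u v uv; rewrite lef_pV2 ?posrE ?(lt_le_trans ltr01) // lerD2r.
case: hyp => _ _ fmono _ [_ a0]; rewrite ler_wpM2l // fmono //.
  by rewrite le_max lexx orbT.
by rewrite ge_max !le_max lerD2r uv lexx orbT.
Qed.

Lemma modified_H_ge0 x : 0 <= modified_H H f alpha c x.
Proof. by apply: Rintegral_ge0 => u _; exact: slope_ge0. Qed.

(** The integrand is at most 1. This makes the weight at most 1, so that [Z_f / Z_0] bounds the
    density of the target. *)
Lemma modified_H_le x : modified_H H f alpha c x <= H x - Hmin H.
Proof.
have := inf_range_le H x; rewrite -/(Hmin H) => Hx.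
have finI : (lebesgue_measure (`[Hmin H, H x]%classic : set R) < +oo)%E.
  by rewrite lebesgue_measure_itv /=; case: ifP => // _; rewrite -EFinD ltry.
have bnd (F : R -> R) : (forall u, 0 <= F u <= 1) ->
    measurable_fun `[Hmin H, H x] F ->
    lebesgue_measure.-integrable `[Hmin H, H x] (EFin \o F).
  move=> F01 mF; apply: measurable_bounded_integrable => //.
  exists 1; split => // k k1 u _ /=; have /andP[F0 F1] := F01 u.
  by rewrite ger0_norm // (le_trans F1) // ltW.
apply: (@le_trans _ _ (\int[lebesgue_measure]_(u in `[Hmin H, H x]) 1)).
  apply: le_Rintegral => //.
  - apply: (bnd slope) => [u|]; first by rewrite slope_ge0 slope_le1.
    exact: nonincreasing_measurable.
  - by apply: (bnd (cst 1)) => // u; rewrite /= ler01 lexx.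
  - by move=> u _; exact: slope_le1.
rewrite Rintegral_cst // mul1r /= lebesgue_measure_itv /= lte_fin.
by case: ltP; rewrite ?subr_ge0.
Qed.

Local Notation E := (modified_H H f alpha c).
Local Notation w := (weight H f alpha c).
Local Notation Zf := (Z_f H f alpha c).
Local Notation nu := (mu_f H f alpha c).

Lemma weight_gt0 x : 0 < w x.
Proof. by rewrite divr_gt0 ?expR_gt0. Qed.

Lemma weight_le1 x : w x <= 1.
Proof. by rewrite ler_pdivrMr ?expR_gt0 // mul1r ler_expR lerN2 modified_H_le. Qed.

Lemma Z_f_gt0 : 0 < Zf. Proof. exact: partition_fun_gt0. Qed.

Lemma Z_0_gt0 : 0 < Z_0 H. Proof. exact: partition_fun_gt0. Qed.

Lemma Z_f_le : Zf <= #|S|%:R.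
Proof.
rewrite -sum1_card natr_sum; apply: ler_sum => x _.
by rewrite -[1%:R]expR0 ler_expR oppr_le0 modified_H_ge0.
Qed.

(** A minimizer of [H] contributes [expR 0]. *)
Lemma Z_0_ge1 : 1 <= Z_0 H.
Proof.
have [x HxE] := inf_range_attained H S_gt0.
rewrite /Z_0 /partition_fun (bigD1 x) //= -/(Hmin H) /Hmin HxE subrr oppr0 expR0.
by rewrite lerDl sumr_ge0 // => y _; exact: expR_ge0.
Qed.

Lemma mu_f_lower_bound : expR (- sup (range E)) / Zf <= inf (range nu).
Proof.
apply: le_inf_range => // x; rewrite ler_wpM2r ?invr_ge0 ?(ltW Z_f_gt0) //.
by rewrite ler_expR lerN2 le_sup_range.
Qed.

Lemma mu_f_min_gt0 : 0 < inf (range nu).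
Proof.
by rewrite (lt_le_trans _ mu_f_lower_bound) // divr_gt0 ?expR_gt0 ?Z_f_gt0.
Qed.

(** The normalized weight is the density of the target with respect to [mu_f]; the shift by [Hmin H]
    cancels in the normalization. *)
Lemma weight_density x : Zf / Z_0 H * w x * nu x = gibbs H x.
Proof.
have -> : gibbs H x = expR (- (H x - Hmin H)) / Z_0 H.
  have -> : Z_0 H = expR (Hmin H) * partition_fun H.
    rewrite /Z_0 /partition_fun mulr_sumr; apply: eq_bigr => y _.
    by rewrite -expRD; congr expR; ring.
  have -> : - (H x - Hmin H) = Hmin H + - H x by ring.
  rewrite expRD -mulf_div divff ?mul1r // gt_eqF // expR_gt0 //.
rewrite /weight /mu_f /gibbs -/Zf; field.
by rewrite !gt_eqF ?expR_gt0 ?Z_f_gt0 ?Z_0_gt0.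
Qed.

(** * Deviation probability and concentration time of the modified chain *)

Variables (d : measure_display) (Omega : measurableType d).
Variables (Q : S -> S -> R) (P : S -> probability Omega R) (X : R -> Omega -> S).
Hypothesis Q_gen : is_generator Q.
Hypothesis Q_sym : symmetric_rates Q.
Hypothesis Q_irr : irreducible_rates Q.
Hypothesis chain : markov_chain (modified_gen H f alpha c Q) P X.
Implicit Type g : S -> R.

Local Notation event := (deviation_event H f alpha c X).
Local Notation m g := (mean (gibbs H) g).
Local Notation gap := (gap_f H f alpha c Q).

(** Multiply by the positive integral of the weight. The free scale [k] later absorbs the
    normalization of the density and the tilting parameter. *)
Lemma deviation_eventE g t eta k : 0 < t -> 0 < k ->
  event g t eta = [set omega |
    0 <= additive_functional X (fun x => k * (w x * (g x - m g - eta))) t omega].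
Proof.
move=> t0 k0; apply/seteqP.
suff eqv om : (eta <= weighted_time_average w g (X ^~ om) t - m g) =
  (0 <= additive_functional X (fun x => k * (w x * (g x - m g - eta))) t om).
  by split => om; rewrite /deviation_event /= eqv.
have -> : (fun x => k * (w x * (g x - m g - eta))) =
    (fun x => k * (w x * g x) + - (k * (m g + eta)) * w x).
  by apply/funext => x; move: (m g) => b; ring.
rewrite (additive_functional_linear chain) //.
have W0 := additive_functional_gt0 chain om weight_gt0 t0.
rewrite /weighted_time_average gt_eqF //.
rewrite -/(additive_functional X (fun x => w x * g x) t om).
rewrite -/(additive_functional X w t om).
rewrite lerBrDl ler_pdivlMr // mulNr subr_ge0 -mulrA ler_pM2l //.
Qed.

(** Every real [t] is covered, because the time bound may be negative when [eps > 1]. For [t < 0]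
    the interval is empty and the average is the constant [0 / 0], so the event is everything or
    nothing. *)
Lemma measurable_deviation_event g t eta : measurable (event g t eta).
Proof.
have [t0|t0|->] := ltgtP t 0; first last.
- have := measurable_observable chain g (lexx 0) measurableT
    (measurable_itv `[eta + m g, +oo[).
  rewrite setTI; congr (measurable _); apply/seteqP.
  by split => om; rewrite /deviation_event /weighted_time_average eqxx /= in_itv /= andbT lerBrDr.
- rewrite (@deviation_eventE _ _ _ 1) //.
  exact: (measurable_additive_functional_ge0 chain).
- have e0 : `[0, t]%classic = set0 :> set R.
    by apply/seteqP; split => // s; rewrite /= in_itv /= => /andP[/le_trans h /h]; rewrite leNgt t0.
  have avg0 om : weighted_time_average w g (X ^~ om) t = 0 / 0.
    by rewrite /weighted_time_average lt_eqF // e0 !Rintegral_set0.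
  have -> : event g t eta = [set _ | eta <= 0 / 0 - m g].
    by apply/seteqP; split => om; rewrite /deviation_event /= avg0.
  have [h|h] := leP eta (0 / 0 - m g).
    by rewrite (_ : [set _ | _] = setT) //; apply/seteqP; split.
  by rewrite (_ : [set _ | _] = set0) //; apply/seteqP; split => // om; rewrite /= leNgt h.
Qed.

(** A weighted average with positive weights stays strictly below [m g + eta] when all values do. *)
Lemma deviation_event_empty g t eta : 0 <= t ->
  (forall x, g x < m g + eta) -> event g t eta = set0.
Proof.
move=> t0 glt; apply/seteqP; split => // om.
have [t00|t_gt0|t00] := ltgtP 0 t; last 2 first.
- by rewrite ltNge t0 in t_gt0.
- rewrite -t00 /deviation_event /weighted_time_average eqxx /= lerBrDl leNgt.
  by rewrite glt.
rewrite (@deviation_eventE _ _ _ 1) //= => A0.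
have v0 x : 0 < - (1 * (w x * (g x - m g - eta))).
  by rewrite mul1r -mulrN mulr_gt0 ?weight_gt0 // -addrA -opprD opprB subr_gt0.
have := additive_functional_gt0 chain om v0 t00.
have -> : (fun x => - (1 * (w x * (g x - m g - eta)))) =
  (fun x => -1 * (1 * (w x * (g x - m g - eta))) + 0 * 0 : R).
  by apply/funext => x; rewrite mulN1r mul0r addr0.
by rewrite (additive_functional_linear chain) // mul0r addr0 mulN1r oppr_gt0 ltNge A0.
Qed.

Variables (a eta eps : R).
Hypothesis a_gt0 : 0 < a.
Hypothesis eta_gt0 : 0 < eta.
Hypothesis eps_gt0 : 0 < eps.

Definition time_bound : R := Zf / Z_0 H
  * ((32 * a ^+ 2 * (1 + eta) ^+ 2) / (gap * eta ^+ 2))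
  * ln (1 / (eps * inf (range nu))).

Let nu_gt0 x : 0 < nu x. Proof. exact: gibbs_gt0. Qed.
Let nu_sum1 : \sum_x nu x = 1. Proof. exact: gibbs_sum1. Qed.
Let M_gen : is_generator (modified_gen H f alpha c Q).
Proof. exact: metropolis_generator. Qed.
Let M_rev x y : nu x * modified_gen H f alpha c Q x y =
  nu y * modified_gen H f alpha c Q y x.
Proof. exact: metropolis_reversible. Qed.
Let M_irr : irreducible_rates (modified_gen H f alpha c Q).
Proof. exact: metropolis_irreducible. Qed.

Lemma nu_min_le1 : inf (range nu) <= 1.
Proof.
have /card_gt0P[x _] := S_gt0.
exact: le_trans (inf_range_le _ x) (nu_le1 nu_gt0 nu_sum1 x).
Qed.

(** On a singleton a function of mean zero is zero, so the set of quotients is empty and its real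
    infimum is 0. *)
Lemma gap_ge0 : 0 <= gap.
Proof.
have [S1|S1] := leqP #|S| 1; last exact/ltW/spectral_gap_gt0.
suff -> : gap = 0 by [].
rewrite /gap_f /spectral_gap (_ : [set _ | _] = set0) ?inf0 //.
apply/seteqP; split => // r [u [u0 mu0 _]]; apply: u0; apply/funext => x.
have all_x y : y = x by exact: (fintype_le1P S1).
move: mu0; rewrite /mean (bigD1 x) //= big1 ?addr0 => [/eqP|y].
  by rewrite mulf_eq0 (gt_eqF (nu_gt0 x)) orbF => /eqP.
by rewrite (all_x y) eqxx.
Qed.

Lemma log_ge0 : eps < 1 -> 0 <= ln (1 / (eps * inf (range nu))).
Proof.
move=> e1; rewrite ln_ge0 // div1r invf_ge1 ?mulr_gt0 ?mu_f_min_gt0 //.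
by rewrite mulr_ile1 ?nu_min_le1 ?(ltW eps_gt0) ?(ltW mu_f_min_gt0) // ltW.
Qed.

Lemma time_bound_ge0 : eps < 1 -> 0 <= time_bound.
Proof.
move=> e1; rewrite mulr_ge0 ?log_ge0 // mulr_ge0 ?divr_ge0 ?(ltW Z_f_gt0) ?(ltW Z_0_gt0) //.
  by apply: mulr_ge0; [apply: mulr_ge0 => //|]; exact: sqr_ge0.
by apply: mulr_ge0; [exact: gap_ge0|exact: sqr_ge0].
Qed.

(** For [eps >= 1] the bound is trivial, and if [g] stays below [m g + eta] the event is empty.
    Otherwise some state [y] has [g y >= m g + eta], which forces [eta <= 2 * a] and at least two
    states, so that the gap is positive and the tail bound applies. *)
Lemma deviation_probability g t x : sup_norm g <= a -> time_bound <= t ->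
  (P x (event g t eta) <= eps%:E)%E.
Proof.
move=> ga tt.
have [e1|e1] := leP 1 eps.
  apply: (le_trans (probability_le1 _ _)); last by rewrite lee_fin.
  exact: measurable_deviation_event.
have t_ge0 : 0 <= t by exact: le_trans (time_bound_ge0 e1) tt.
have [glt|] := pselect (forall x, g x < m g + eta).
  by rewrite deviation_event_empty // measure0 lee_fin ltW.
move=> /existsNP[y /negP]; rewrite -leNgt => gy.
have g_le z : `|g z| <= a by exact: le_trans (le_sup_range (fun x => `|g x|) z) ga.
pose K := Zf / Z_0 H.
have K0 : 0 < K by rewrite divr_gt0 ?Z_f_gt0 ?Z_0_gt0.
pose rho z := K * w z.
have rho0 z : 0 <= rho z by rewrite mulr_ge0 ?(ltW K0) ?(ltW (weight_gt0 z)).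
have rhoK z : rho z <= K by rewrite ler_piMr ?(ltW K0) // weight_le1.
have rho_m u : mean nu (fun z => rho z * u z) = m u.
  rewrite /mean; apply: eq_bigr => z _; rewrite -weight_density /rho /K; ring.
have rho1 : mean nu rho = 1.
  have := rho_m (fun=> 1).
  have -> : (fun z => rho z * 1) = rho by apply/funext => z; rewrite mulr1.
  by move=> ->; rewrite /mean -[RHS](gibbs_sum1 H S_gt0); apply: eq_bigr => z _; rewrite mul1r.
have mga : - a <= m g.
  rewrite lerNl -[leRHS]mulr1 -(gibbs_sum1 H S_gt0) mulr_sumr /mean -sumrN.
  apply: ler_sum => z _; rewrite -mulNr ler_wpM2r ?(ltW (gibbs_gt0 H z)) //.
  by rewrite (le_trans (ler_norm _)) // normrN.
have eta2a : eta <= 2 * a.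
  have := g_le y; rewrite ler_norml => /andP[_ gya].
  by move: (m g) gy mga => b; have := eta_gt0; lra.
(* On a single state [g] equals its mean and cannot exceed it by [eta]. *)
have S1 : (1 < #|S|)%N.
  rewrite ltnNge; apply/negP => S1.
  have all_y z : z = y by exact: (fintype_le1P S1).
  have mE : m g = g y.
    rewrite -[RHS]mulr1 -(gibbs_sum1 H S_gt0) mulr_sumr.
    by apply: eq_bigr => z _; rewrite (all_y z).
  by move: gy; rewrite mE gerDl leNgt eta_gt0.
have gap0 : 0 < gap by exact: spectral_gap_gt0.
have L0 : 0 < ln (1 / (eps * inf (range nu))).
  rewrite ln_gt0 // div1r invf_gt1 ?mulr_gt0 ?mu_f_min_gt0 //.
  by rewrite (le_lt_trans _ e1) // ler_piMr ?(ltW eps_gt0) // nu_min_le1.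
have t0 : 0 < t.
  apply: lt_le_trans tt; rewrite /time_bound -/K.
  apply: mulr_gt0 L0; apply: (mulr_gt0 K0).
  by apply: divr_gt0; [rewrite !mulr_gt0 ?exprn_gt0 ?addr_gt0|rewrite mulr_gt0 ?exprn_gt0].
pose lam := gap * eta ^+ 2 / (32 * a ^+ 2 * K).
have lam0 : 0 < lam.
  apply: divr_gt0; first by rewrite mulr_gt0 ?exprn_gt0.
  by apply: mulr_gt0 K0; rewrite mulr_gt0 ?exprn_gt0.
have th0 : 0 < 2 * lam / eta by rewrite divr_gt0 // mulr_gt0.
have form := tilted_form_le nu_gt0 nu_sum1 M_gen M_rev gap0 rho0 rhoK rho1 a_gt0
  g_le eta_gt0 eta2a.
rewrite rho_m -/lam in form.
have := additive_functional_tail chain nu_gt0 nu_sum1 form x t0.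
have -> : (fun z => 2 * lam / eta * (rho z * (g z - m g - eta))) =
  (fun z => 2 * lam / eta * K * (w z * (g z - m g - eta))).
  by apply/funext => z; rewrite /rho -!mulrA.
rewrite -(deviation_eventE g eta t0 (mulr_gt0 th0 K0)).
move=> /le_trans; apply; rewrite lee_fin.
have nm0 := mu_f_min_gt0.
apply: (@le_trans _ _ (expR (- (t * lam)) / inf (range nu))).
  by rewrite ler_wpM2l ?expR_ge0 // lef_pV2 ?posrE ?inf_range_le.
rewrite ler_pdivrMr // -[leRHS]lnK ?posrE ?mulr_gt0 // ler_expR lerNl.
have -> : - ln (eps * inf (range nu)) = ln (1 / (eps * inf (range nu))).
  by rewrite div1r lnV // posrE mulr_gt0.
(* The factor [(1 + eta) ^+ 2 >= 1] of the time bound is slack here: [t * lam] only has to reach the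
   logarithm. *)
apply: (@le_trans _ _ ((1 + eta) ^+ 2 * ln (1 / (eps * inf (range nu))))).
  by rewrite ler_peMl ?(ltW L0) // exprn_ege1 // lerDl ltW.
have -> : (1 + eta) ^+ 2 * ln (1 / (eps * inf (range nu))) = time_bound * lam.
  rewrite /time_bound /lam -/K; move: (ln _) => l; field.
  by rewrite !gt_eqF.
by rewrite ler_wpM2r // ltW.
Qed.

(** Two replacements: [Z_f / Z_0 <= #|S|], and [1 / min mu_f <= #|S| * exp (max E)] inside the
    logarithm. *)
Lemma time_bound_le : eps < 1 -> time_bound <=
  32 * `| #|S|%:R * ((a ^+ 2 * (1 + eta) ^+ 2) / (gap * eta ^+ 2))
    * ln (#|S|%:R * expR (sup (range E)) / eps) |.
Proof.
move=> e1; apply: le_trans (ler_wpM2l _ (ler_norm _)) => //.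
have c0 : 0 <= (a ^+ 2 * (1 + eta) ^+ 2) / (gap * eta ^+ 2).
  by rewrite divr_ge0 // mulr_ge0 ?sqr_ge0 ?gap_ge0.
have -> : time_bound = 32 * (Zf / Z_0 H *
    ((a ^+ 2 * (1 + eta) ^+ 2) / (gap * eta ^+ 2))
    * ln (1 / (eps * inf (range nu)))).
  rewrite /time_bound -!mulrA; ring.
rewrite ler_wpM2l //.
have KS : Zf / Z_0 H <= #|S|%:R.
  by rewrite ler_pdivrMr ?Z_0_gt0 // (le_trans Z_f_le) // ler_peMr ?Z_0_ge1.
apply: ler_pM; last first.
have nm0 := mu_f_min_gt0.
have card0 : 0 < #|S|%:R :> R by rewrite ltr0n.
rewrite ler_ln ?posrE ?divr_gt0 ?mulr_gt0 ?expR_gt0 //.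
rewrite div1r invfM mulrC ler_wpM2r ?invr_ge0 ?(ltW eps_gt0) //.
rewrite invf_ple ?posrE ?mulr_gt0 ?expR_gt0 //.
apply: le_trans mu_f_lower_bound.
rewrite invfM -expRN mulrC ler_wpM2l ?expR_ge0 // lef_pV2 ?posrE ?Z_f_gt0 //.
exact: Z_f_le.
- by rewrite ler_wpM2r.
- exact: log_ge0.
- by apply: mulr_ge0 c0; apply: divr_ge0; apply: ltW; [exact: Z_f_gt0|exact: Z_0_gt0].
Qed.

Lemma t_conc_bounds t : 0 <= t -> (1 <= eps \/ time_bound <= t) ->
  (0 <= t_conc H f alpha c P X a eta eps <= t%:E)%E.
Proof.
move=> t0 tb; apply/andP; split.
  by apply: le_ereal_inf_tmp => _ [s [s0 _] <-]; rewrite lee_fin.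
apply: ereal_inf_lbound; exists t => //; split => //.
apply: ge_ereal_sup => _ [g [x [ga ->]]]; case: tb => [e1|].
  apply: (le_trans (probability_le1 _ _)); last by rewrite lee_fin.
  exact: measurable_deviation_event.
exact: deviation_probability.
Qed.

Lemma t_conc_le : (`| t_conc H f alpha c P X a eta eps | <=
  (32 * `| #|S|%:R * ((a ^+ 2 * (1 + eta) ^+ 2) / (gap * eta ^+ 2))
     * ln (#|S|%:R * expR (sup (range E)) / eps) |)%:E)%E.
Proof.
have [e1|e1] := leP 1 eps.
  (* For [eps >= 1] time 0 already qualifies, so the concentration time is 0. *)
  have /andP[t0 tle] := t_conc_bounds (lexx 0) (or_introl e1).
  by rewrite gee0_abs // (le_trans tle) // lee_fin mulr_ge0.
have /andP[t0 tle] := t_conc_bounds (time_bound_ge0 e1) (or_intror (lexx _)).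
by rewrite gee0_abs // (le_trans tle) // lee_fin time_bound_le.
Qed.

End LandscapeModification.

Theorem theorem4p3 (R : realType) :
  exists C : R, 0 < C /\
  forall (S : finType) (H : S -> R) (Q : S -> S -> R)
    (f : R -> R) (alpha c : R)
    (d : measure_display) (Omega : measurableType d)
    (P : S -> probability Omega R) (X : R -> Omega -> S)
    (a eta eps : R),
  (0 < #|S|)%N ->
  is_generator Q -> symmetric_rates Q -> irreducible_rates Q ->
  standing_assumption H f alpha c ->
  markov_chain (modified_gen H f alpha c Q) P X ->
  0 < a -> 0 < eta -> 0 < eps ->
  (forall (g : S -> R) (t : R),
     sup_norm g <= a ->
     Z_f H f alpha c / Z_0 H
       * ((32 * a ^+ 2 * (1 + eta) ^+ 2) / (gap_f H f alpha c Q * eta ^+ 2))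
       * ln (1 / (eps * inf (range (mu_f H f alpha c)))) <= t ->
     forall x : S,
       (P x (deviation_event H f alpha c X g t eta) <= eps%:E)%E)
  /\
  (`| t_conc H f alpha c P X a eta eps | <=
     (C * `| #|S|%:R
             * ((a ^+ 2 * (1 + eta) ^+ 2) / (gap_f H f alpha c Q * eta ^+ 2))
             * ln (#|S|%:R * expR (sup (range (modified_H H f alpha c)))
                   / eps) |)%:E)%E.
Proof.
(* The absolute constant is the numerical factor of the explicit time bound. *)
exists 32; split => // S H Q f alpha c d Omega P X a eta eps S0 Q_gen Q_sym Q_irr hyp
  chain a0 eta0 eps0.
split => [g t ga tt x|].
  exact: (deviation_probability S0 hyp Q_gen Q_sym Q_irr chain a0 eta0 eps0 x ga tt).
exact: t_conc_le.
Qed.
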